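(* Let $M^{2n+1}(\varphi,Q,\xi,\eta,g)$ be a weak $K$-contact manifold. Then for all vector fields $X,Y$ on $M$ the following equalities are true: $$R_{\xi,X}\,Y=(\nabla_X\,\varphi)Y,\qquad R_{X,\xi}\,\xi=-\varphi^2X,\qquad \mathrm{Ric}(\xi,\xi)=\mathrm{trace}\,Q=2n+\mathrm{trace}\,\tilde Q,$$ where $\tilde Q=Q-\mathrm{id}_{TM}$.
   Context: $\nabla$ is the Levi-Civita connection of $g$, $R_{X,Y}Z=\nabla_X\nabla_YZ-\nabla_Y\nabla_XZ-\nabla_{[X,Y]}Z$ is the curvature tensor, and $\mathrm{Ric}$ is the Ricci tensor; the Ricci curvature in the $\xi$-direction is $\mathrm{Ric}(\xi,\xi)=\sum_{i=1}^{2n}g(R_{e_i,\xi}\,\xi,e_i)$ for any local orthonormal basis $(e_i)$ of $\mathcal D=\ker\eta$. A weak almost contact structure on a smooth manifold $M^{2n+1}$ is a set $(\varphi,Q,\xi,\eta)$, where $\varphi$ is a $(1,1)$-tensor field, $Q$ is a nonsingular $(1,1)$-tensor field, $\xi$ is a vector field (the Reeb vector field) and $\eta$ is a 1-form with $\eta(\xi)=1$, satisfying $\varphi^2=-Q+\eta\otimes\xi$ and $Q\xi=\xi$; moreover, the distribution $\mathcal D=\ker\eta$ is assumed to be $\varphi$-invariant ($\varphi X\in\mathcal D$ for $X\in\mathcal D$). A weak almost contact metric structure $(\varphi,Q,\xi,\eta,g)$ is a weak almost contact structure together with a Riemannian metric $g$ such that $g(\varphi X,\varphi Y)=g(X,QY)-\eta(X)\eta(Y)$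 for all vector fields $X,Y$. A weak contact metric structure is a weak almost contact metric structure such that $\Phi=d\eta$, where $\Phi(X,Y)=g(X,\varphi Y)$ and $d\eta(X,Y)=\frac12\{X(\eta(Y))-Y(\eta(X))-\eta([X,Y])\}$. A weak $K$-contact manifold is a weak contact metric manifold whose Reeb vector field $\xi$ is Killing, i.e., $\mathcal L_\xi g=0$. Convention: $\mathrm{trace}\,Q$ denotes the trace over $\mathcal D$, i.e., $\mathrm{trace}\,Q=\sum_{i=1}^{2n}g(Qe_i,e_i)$ for any local orthonormal basis $(e_i)$ of $\mathcal D$. *)

(* Defs.v *)
From HB Require Import structures.
From mathcomp Require Import all_boot all_order all_algebra.
From mathcomp Require Import all_classical all_reals all_analysis.
From mathcomp Require Import ring.

Set Implicit Arguments.
Unset Strict Implicit.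
Unset Printing Implicit Defensive.

Import Order.TTheory GRing.Theory Num.Theory.
Import numFieldNormedType.Exports.
Local Open Scope classical_set_scope.
Local Open Scope ring_scope.

Lemma near_eq_continuous (T U : topologicalType) (f g : T -> U) (x : T) :
  (\forall y \near x, f y = g y) -> {for x, continuous f} ->
  {for x, continuous g}.
Proof.
move=> fg; rewrite /prop_for /continuous_at -(nbhs_singleton fg).
by apply: cvg_trans; exact: near_eq_cvg.
Qed.

Section Euclidean.
Variables (R : realType) (m : nat).
Implicit Types (U : set 'rV[R]_m) (f g : 'rV[R]_m -> R).

Fixpoint Ck (k : nat) (U : set 'rV[R]_m) (f : 'rV[R]_m -> R) : Prop :=
  (forall x, U x -> {for x, continuous f}) /\
  match k with
  | 0 => True
  | k'.+1 => forall i : 'I_m,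
      (forall x, U x -> derivable f x (delta_mx 0 i)) /\
      Ck k' U (fun x => 'D_(delta_mx 0 i) f x)
  end.

Definition smooth_on U f : Prop := forall k, Ck k U f.

Lemma Ck_continuous k U f : Ck k U f -> forall x, U x -> {for x, continuous f}.
Proof. by case: k => [|k] []. Qed.

Lemma CkW k U f : Ck k.+1 U f -> Ck k U f.
Proof.
elim: k f => [|k IH] f [cf df]; split=> // i.
by have [df1 df2] := df i; split=> //; exact: IH.
Qed.

Lemma eq_Ck k U f g : open U -> (forall x, U x -> f x = g x) ->
  Ck k U f -> Ck k U g.
Proof.
move=> oU; elim: k f g => [|k IH] f g fg [cf df].
  split=> // x Ux; have fgx : \forall y \near x, f y = g y.
    by apply: filterS (open_nbhs_nbhs (conj oU Ux)) => y /fg.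
  exact: near_eq_continuous fgx (cf x Ux).
have nfg x : U x -> \forall y \near x, f y = g y.
  by move=> Ux; apply: filterS (open_nbhs_nbhs (conj oU Ux)) => y /fg.
split=> [x Ux|i]; first exact: near_eq_continuous (nfg x Ux) (cf x Ux).
have [df1 df2] := df i; split=> [x Ux|].
  by apply: near_eq_derivable (df1 x Ux); exact: nfg.
by apply: IH df2 => x Ux; apply: near_eq_derive; exact: nfg.
Qed.

Lemma Ck_cst k U (c : R) : Ck k U (cst c).
Proof.
elim: k c => [|k IH] c; (split; first by move=> x _; exact: (@cst_continuous _ _ c x)) => // i.
split=> [x _|]; first exact: derivable_cst.
by under eq_fun do rewrite derive_cst; exact: IH.
Qed.

Lemma CkD k U f g : open U -> Ck k U f -> Ck k U g -> Ck k U (f + g).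
Proof.
move=> oU; elim: k f g => [|k IH] f g [cf df] [cg dg];
  (split; first by move=> x Ux; exact: continuousD (cf _ Ux) (cg _ Ux)) => // i.
 have [df1 df2] := df i; have [dg1 dg2] := dg i; split=> [x Ux|].
  by apply: derivableD; [exact: df1|exact: dg1].
apply: eq_Ck (IH _ _ df2 dg2) => // x Ux.
by rewrite deriveD//; [exact: df1|exact: dg1].
Qed.

Lemma CkM k U f g : open U -> Ck k U f -> Ck k U g -> Ck k U (f * g).
Proof.
move=> oU; elim: k f g => [|k IH] f g Cf Cg.
all: have cfg x (Ux : U x) : {for x, continuous (f * g)}
    by exact: continuousM (Ck_continuous Cf Ux) (Ck_continuous Cg Ux).
  by split.
split=> // i; have [_ /(_ i)[df1 df2]] := Cf; have [_ /(_ i)[dg1 dg2]] := Cg.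
split=> [x Ux|]; first by apply: derivableM; [exact: df1|exact: dg1].
apply: (@eq_Ck k U (f * (fun x => 'D_(delta_mx 0 i) g x)
                     + g * (fun x => 'D_(delta_mx 0 i) f x))) => // [x Ux|].
  by rewrite deriveM//; [exact: df1|exact: dg1].
by apply: CkD => //; apply: IH => //; exact: CkW.
Qed.

End Euclidean.

Record chart (R : realType) (m : nat) (T : topologicalType) := Chart {
  dom : set T;
  fwd : T -> 'rV[R]_m;
  bwd : 'rV[R]_m -> T;
  dom_open : open dom;
  img_open : open (fwd @` dom);
  fwdK : {in dom, cancel fwd bwd};
  fwd_continuous : forall p, dom p -> {for p, continuous fwd};
  bwd_continuous : forall x, (fwd @` dom) x -> {for x, continuous bwd} }.

Definition compatible (R : realType) (m : nat) (T : topologicalType)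
    (c d : chart R m T) : Prop :=
  forall j : 'I_m,
    smooth_on (fwd c @` (dom c `&` dom d)) (fun x => fwd d (bwd c x) 0 j).

(* The atlas is not required to be maximal: a function is smooth for an atlas
   iff it is smooth for the maximal atlas containing it. *)
Record manifold (R : realType) (m : nat) := Manifold {
  carrier :> topologicalType;
  atlas : set (chart R m carrier);
  manifold_hausdorff : hausdorff_space carrier;
  manifold_second_countable : @second_countable carrier;
  atlas_cover : forall p, exists2 c, atlas c & dom c p;
  atlas_compatible : forall c d, atlas c -> atlas d -> compatible c d }.

Section SmoothFunctions.
Variables (R : realType) (m : nat) (M : manifold R m).

Definition smooth_fun (f : M -> R) : Prop :=
  forall c, atlas c -> smooth_on (fwd c @` dom c) (f \o bwd c).

Definition smooth_pred : {pred M -> R} := fun f => `[< smooth_fun f >].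

Lemma smooth_pred_subring : subring_closed smooth_pred.
Proof.
have sM : {in smooth_pred &, forall f g, f * g \in smooth_pred}.
  move=> f g /asboolP sf /asboolP sg; apply/asboolP => c Ac k.
  by apply: CkM; [exact: img_open|exact: sf|exact: sg].
have s_cst r : (cst r : M -> R) \in smooth_pred.
  by apply/asboolP => c Ac k; exact: Ck_cst.
split=> //; first exact: (s_cst 1).
move=> f g sf /(sM _ _ (s_cst (-1))) sg.
have -> : f - g = f + cst (-1) * g.
  by apply/funext => x; rewrite /GRing.add/= /GRing.mul/= mulN1r.
move: sf sg => /asboolP sf /asboolP sg; apply/asboolP => c Ac k.
by apply: CkD; [exact: img_open|exact: sf|exact: sg].
Qed.

HB.instance Definition _ :=
  GRing.isSubringClosed.Build (M -> R) smooth_pred smooth_pred_subring.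

Lemma smooth_pred_scale : GRing.scaler_closed smooth_pred.
Proof.
move=> r f /asboolP sf; apply/asboolP => c Ac k.
by apply: (CkM (@img_open _ _ _ c) (Ck_cst k _ r)); exact: sf.
Qed.

HB.instance Definition _ :=
  GRing.isScaleClosed.Build R (M -> R) smooth_pred smooth_pred_scale.

Record cinfty := CInfty { cinfty_fun :> M -> R; _ : cinfty_fun \in smooth_pred }.

HB.instance Definition _ := [isSub for cinfty_fun].
HB.instance Definition _ := [Choice of cinfty by <:].
HB.instance Definition _ := GRing.SubChoice_isSubComPzRing.Build (M -> R)
  smooth_pred cinfty smooth_pred_subring.
HB.instance Definition _ := [SubZmodule_isSubLmodule of cinfty by <:].

End SmoothFunctions.

Section VectorFields.
Variables (R : realType) (m : nat) (M : manifold R m).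
Local Notation C := (cinfty M).

(* Vector fields are taken to be the R-linear derivations of C^oo(M). *)
Definition derivation (X : C -> C) : Prop :=
  (forall (a : R) f g, X (a *: f + g) = a *: X f + X g) /\
  (forall f g, X (f * g) = X f * g + f * X g).

Definition derivation_pred : {pred C -> C} := fun X => `[< derivation X >].

Lemma derivation_zmod : zmod_closed derivation_pred.
Proof.
split.
  by apply/asboolP; split=> [a f g|f g];
    rewrite /GRing.zero/= ?scaler0 ?mul0r ?mulr0 addr0.
move=> X Y /asboolP[XZ XM] /asboolP[YZ YM]; apply/asboolP.
have E f : (X - Y) f = X f - Y f by [].
split=> [a f g|f g]; rewrite !E.
  by rewrite XZ YZ scalerBr opprD addrACA.
by rewrite XM YM mulrBl mulrBr opprD addrACA.
Qed.

HB.instance Definition _ :=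
  GRing.isZmodClosed.Build (C -> C) derivation_pred derivation_zmod.

Record vfield := VField { vf_fun :> C -> C; _ : vf_fun \in derivation_pred }.

HB.instance Definition _ := [isSub for vf_fun].
HB.instance Definition _ := [Choice of vfield by <:].
HB.instance Definition _ := [SubChoice_isSubZmodule of vfield by <:].

Lemma vf_scale_subproof (h : C) (X : vfield) :
  (fun f => h * X f) \in derivation_pred.
Proof.
case: X => X /= /asboolP[XZ XM]; apply/asboolP; split=> [a f g|f g].
  rewrite XZ mulrDr; congr (_ + _); apply/val_inj/funext => p /=.
  by rewrite /GRing.scale/= /GRing.mul/= mulrCA.
by rewrite XM mulrDr mulrA mulrCA.
Qed.

Definition vf_scale (h : C) (X : vfield) : vfield :=
  VField (vf_scale_subproof h X).

Lemma vfP (X Y : vfield) : X =1 Y -> X = Y.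
Proof. by move=> XY; apply/val_inj/funext. Qed.

Lemma vf_scaleA a b X : vf_scale a (vf_scale b X) = vf_scale (a * b) X.
Proof. by apply: vfP => f /=; rewrite mulrA. Qed.
Lemma vf_scale1 : left_id 1 vf_scale.
Proof. by move=> X; apply: vfP => f /=; rewrite mul1r. Qed.
Lemma vf_scaleDr : right_distributive vf_scale +%R.
Proof. by move=> a X Y; apply: vfP => f /=; rewrite mulrDr. Qed.
Lemma vf_scaleDl X : {morph vf_scale^~ X : a b / a + b}.
Proof. by move=> a b; apply: vfP => f /=; rewrite mulrDl. Qed.

HB.instance Definition _ := GRing.Zmodule_isLmodule.Build C vfield
  vf_scaleA vf_scale1 vf_scaleDr vf_scaleDl.

Lemma lie_subproof (X Y : vfield) :
  (fun f => X (Y f) - Y (X f)) \in derivation_pred.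
Proof.
case: X Y => X /= /asboolP[XZ XM] [Y /= /asboolP[YZ YM]]; apply/asboolP.
have XD f g : X (f + g) = X f + X g by rewrite -[f]scale1r XZ !scale1r.
have YD f g : Y (f + g) = Y f + Y g by rewrite -[f]scale1r YZ !scale1r.
split=> [a f g|f g]; first by rewrite !(XZ, YZ) scalerBr opprD addrACA.
rewrite !(XM, YM, XD, YD).
ring.
Qed.

Definition lie (X Y : vfield) : vfield := VField (lie_subproof X Y).

(* The tangent vector X_p, i.e. f |-> (X f)(p), is zero. *)
Definition vanishes_at (X : vfield) (p : M) : Prop := forall f, X f p = 0.

(* The tensor fields below are C^oo(M)-(multi)linear maps on the module of
   vector fields. *)
Record metric := Metric {
  metric_fun :> vfield -> vfield -> C;
  metric_linearl : forall (a : C) (X Y Z : vfield),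
    metric_fun (a *: X + Y) Z = a * metric_fun X Z + metric_fun Y Z;
  metric_sym : forall X Y : vfield, metric_fun X Y = metric_fun Y X;
  metric_pos : forall (X : vfield) (p : M), ~ vanishes_at X p -> 0 < metric_fun X X p }.

Record levi_civita (g : metric) (nabla : vfield -> vfield -> vfield) : Prop := {
  nabla_linearl : forall (a : C) (X Y Z : vfield),
    nabla (a *: X + Y) Z = a *: nabla X Z + nabla Y Z;
  nabla_addr : forall X Y Z : vfield, nabla X (Y + Z) = nabla X Y + nabla X Z;
  (* homogeneity over R is the case of a constant f *)
  nabla_leibniz : forall (X : vfield) (f : C) (Y : vfield),
    nabla X (f *: Y) = X f *: Y + f *: nabla X Y;
  nabla_torsion_free : forall X Y : vfield, nabla X Y - nabla Y X = lie X Y;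
  nabla_metric : forall X Y Z : vfield,
    X (g Y Z) = g (nabla X Y) Z + g Y (nabla X Z) }.

Definition curvature (nabla : vfield -> vfield -> vfield) (X Y Z : vfield) :
    vfield :=
  nabla X (nabla Y Z) - nabla Y (nabla X Z) - nabla (lie X Y) Z.

(* (nabla_X T) Y for a (1,1)-tensor field T *)
Definition nabla_endo (nabla : vfield -> vfield -> vfield)
    (T : vfield -> vfield) (X Y : vfield) : vfield :=
  nabla X (T Y) - T (nabla X Y).

Definition lie_metric (xi : vfield) (g : metric) (X Y : vfield) : C :=
  xi (g X Y) - g (lie xi X) Y - g X (lie xi Y).

Definition killing (xi : vfield) (g : metric) : Prop :=
  forall X Y, lie_metric xi g X Y = 0.

Definition ext_d (eta : vfield -> C) (X Y : vfield) : C :=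
  (2%:R^-1 : R) *: (X (eta Y) - Y (eta X) - eta (lie X Y)).

End VectorFields.

Section WeakContact.
Variables (R : realType) (n : nat) (M : manifold R (2 * n).+1).
Local Notation C := (cinfty M).
Local Notation V := (vfield M).
Implicit Types (phi Q : {linear V -> V}) (xi : V) (eta : {linear V -> C | *%R}).
Implicit Types (g : metric M) (nabla : V -> V -> V).

Record weak_almost_contact phi Q xi eta : Prop := {
  wac_eta_xi : eta xi = 1;
  wac_phi2 : forall X : V, phi (phi X) = - Q X + eta X *: xi;
  wac_Q_xi : Q xi = xi;
  (* A field of endomorphisms is nonsingular at every point iff it is
     invertible on the module of vector fields. *)
  wac_Q_nonsingular : bijective Q;
  wac_invariant : forall X : V, eta X = 0 -> eta (phi X) = 0 }.

Record weak_almost_contact_metric phi Q xi eta g : Prop := {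
  wacm_wac : weak_almost_contact phi Q xi eta;
  wacm_metric : forall X Y : V, g (phi X) (phi Y) = g X (Q Y) - eta X * eta Y }.

Record weak_contact_metric phi Q xi eta g : Prop := {
  wcm_wacm : weak_almost_contact_metric phi Q xi eta g;
  wcm_dPhi : forall X Y : V, g X (phi Y) = ext_d eta X Y }.

Record weak_K_contact phi Q xi eta g : Prop := {
  wK_wcm : weak_contact_metric phi Q xi eta g;
  wK_killing : killing xi g }.

(* The tangent vectors (e_i)_p form an orthonormal basis of D_p, where
   D = ker eta. Every orthonormal basis of D_p is of this form for some global
   fields e_i; at a point p of its domain, a local orthonormal basis of D
   coincides near p with such fields. *)
Definition orthonormal_basis_D eta g (p : M) (e : 'I_(2 * n) -> V) : Prop :=
  [/\ forall i, eta (e i) p = 0,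
      forall i j, g (e i) (e j) p = (i == j)%:R &
      forall X : V, eta X p = 0 -> exists c : 'I_(2 * n) -> R,
        forall f : C, X f p = \sum_i c i * e i f p].

Definition trace_D g (p : M) (e : 'I_(2 * n) -> V) (A : V -> V) : R :=
  \sum_i g (A (e i)) (e i) p.

(* The term of the full trace along xi is absent since R_{xi,xi} = 0. *)
Definition Ric_xi nabla g xi (p : M) (e : 'I_(2 * n) -> V) : R :=
  trace_D g p e (fun X => curvature nabla X xi xi).

End WeakContact.

(* Main.v *)
Require Import Defs.
From HB Require Import structures.
From mathcomp Require Import all_boot all_order all_algebra.
From mathcomp Require Import all_classical all_reals all_analysis.
From mathcomp Require Import ring lra.

Set Implicit Arguments.
Unset Strict Implicit.
Unset Printing Implicit Defensive.

Import Order.TTheory GRing.Theory Num.Theory.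
Import numFieldNormedType.Exports.
Local Open Scope classical_set_scope.
Local Open Scope ring_scope.

(** Since [xi] is Killing and [Phi = d eta], [nabla_X xi = - phi X]; hence
    [R_{X,Y} xi = (nabla_Y phi) X - (nabla_X phi) Y].  The form
    [g ((nabla_X phi) Y) Z] is skew in [Y, Z] and, by the first Bianchi identity,
    has vanishing cyclic sum, so the pair symmetry of the curvature turns this
    formula into [R_{xi,X} Y = (nabla_X phi) Y].  Taking [X = xi] gives
    [nabla_xi phi = 0], and then [R_{X,xi} xi = - phi^2 X].

    The trace formula compares fields that are only known to span at one point, so
    it needs [g X Y p] to depend on the tangent vectors at [p] alone.  As vector
    fields are derivations, this amounts to writing a field that vanishes at [p],
    up to a cut-off function that is nonzero at [p], as a combination of coordinate
    fields with coefficients that vanish at [p]; this follows from Hadamard's lemma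
    [h x - h a = sum_i (x_i - a_i) h_i x] with smooth [h_i]. *)

(** * Curvature of a Levi-Civita connection *)

(** Take the cyclic identity for [X, Y, Z, W] and for the three cyclic shifts of these arguments.
    The first two minus the last two leave twice the difference of the two sides, once the skew
    symmetries have matched the remaining terms. *)
Lemma pair_symmetry (R : realFieldType) (V : Type) (T : V -> V -> V -> V -> R) :
  (forall X Y Z W, T X Y Z W = - T Y X Z W) ->
  (forall X Y Z W, T X Y Z W = - T X Y W Z) ->
  (forall X Y Z W, T X Y Z W + T Y Z X W + T Z X Y W = 0) ->
  forall X Y Z W, T X Y Z W = T Z W X Y.
Proof.
move=> s12 s34 b X Y Z W.
move: (b X Y Z W) (b Y Z W X) (b Z W X Y) (b W X Y Z).
rewrite (s34 Y Z W X) (s12 X Z W Y) (s34 Z X W Y) (s34 Z W Y X).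
rewrite (s12 Y W X Z) (s34 W Y X Z) (s34 W X Y Z) (s34 X Y W Z).
lra.
Qed.

(** * Evaluation of functions and fields *)

Section PointwiseEvaluation.
Variables (R : realType) (m : nat) (M : manifold R m).
Implicit Types (a b f h : cinfty M) (p : M) (X Y Z : vfield M).

Lemma cinftyDE a b p : (a + b) p = a p + b p. Proof. by []. Qed.
Lemma cinftyNE a p : (- a) p = - a p. Proof. by []. Qed.
Lemma cinftyME a b p : (a * b) p = a p * b p. Proof. by []. Qed.
Lemma cinftyZE (r : R) a p : (r *: a) p = r * a p. Proof. by []. Qed.
Lemma cinfty0E p : (0 : cinfty M) p = 0. Proof. by []. Qed.
Lemma cinfty1E p : (1 : cinfty M) p = 1. Proof. by []. Qed.
Definition cinftyE :=
  (cinftyDE, cinftyNE, cinftyME, cinftyZE, cinfty0E, cinfty1E).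

Lemma cinftyP a b : (forall p, a p = b p) -> a = b.
Proof. by move=> ab; apply/val_inj/funext. Qed.

Lemma vfieldB X f h : X (f - h) = X f - X h.
Proof.
case: X => X /= /asboolP[XZ _].
have := XZ (-1) h f; rewrite addrC !scaleN1r => ->.
by rewrite addrC.
Qed.

Lemma vfieldD X f h : X (f + h) = X f + X h.
Proof.
by case: X => X /= /asboolP[XZ _]; have := XZ 1 f h; rewrite !scale1r.
Qed.

Lemma vfieldM X f h : X (f * h) = X f * h + f * X h.
Proof. by case: X => X /= /asboolP[_ ->]. Qed.

Lemma vfield_cst X (r : R) f : X (r *: f) = r *: X f.
Proof.
case: X => X /= /asboolP[XZ _]; have := XZ r f 0; rewrite !addr0 => ->.
have := XZ 1 0 0; rewrite !scale1r addr0 => /esym/eqP.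
by rewrite -subr_eq0 addrK => /eqP ->; rewrite addr0.
Qed.

Lemma vfieldDE X Y f : (X + Y) f = X f + Y f. Proof. by []. Qed.
Lemma vfieldNE X f : (- X) f = - X f. Proof. by []. Qed.
Lemma vfieldZE a X f : (a *: X) f = a * X f. Proof. by []. Qed.
Lemma vfield0E f : (0 : vfield M) f = 0. Proof. by []. Qed.
Definition vfieldE := (vfieldDE, vfieldNE, vfieldZE, vfield0E).

Lemma vfield_sumE (I : Type) (r : seq I) (F : I -> vfield M) f :
  (\sum_(i <- r) F i) f = \sum_(i <- r) F i f.
Proof. by apply: (big_morph (fun X : vfield M => X f)). Qed.

Lemma vfield_sum Z (I : Type) (r : seq I) (F : I -> cinfty M) :
  Z (\sum_(i <- r) F i) = \sum_(i <- r) Z (F i).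
Proof.
elim: r => [|i r IH]; last by rewrite !big_cons vfieldD IH.
by rewrite !big_nil -(scale0r (0 : cinfty M)) vfield_cst !scale0r.
Qed.

Lemma cinfty_sumE (I : Type) (r : seq I) (F : I -> cinfty M) q :
  (\sum_(i <- r) F i) q = \sum_(i <- r) F i q.
Proof. by apply: (big_morph (fun f : cinfty M => f q)). Qed.

End PointwiseEvaluation.

(** * Metric, connection and the symmetries of the curvature *)

Section Riemannian.
Variables (R : realType) (m : nat) (M : manifold R m).
Local Notation C := (cinfty M).
Local Notation V := (vfield M).

Lemma lieC (X Y : V) : lie Y X = - lie X Y.
Proof. by apply: vfP => f /=; rewrite opprB. Qed.

Lemma lie_jacobi (X Y Z : V) :
  lie X (lie Y Z) + lie Y (lie Z X) + lie Z (lie X Y) = 0.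
Proof.
apply: vfP => f.
by rewrite !vfieldE /= !vfieldB; ring.
Qed.

Variable g : metric M.

Lemma metricDl X Y Z : g (X + Y) Z = g X Z + g Y Z.
Proof. by have := metric_linearl g 1 X Y Z; rewrite scale1r mul1r. Qed.
Lemma metric0l Z : g 0 Z = 0.
Proof. by apply: (addIr (g 0 Z)); rewrite -metricDl addr0 add0r. Qed.
Lemma metricZl a X Z : g (a *: X) Z = a * g X Z.
Proof. by have := metric_linearl g a X 0 Z; rewrite metric0l !addr0. Qed.
Lemma metricNl X Z : g (- X) Z = - g X Z.
Proof. by rewrite -scaleN1r metricZl mulN1r. Qed.
Lemma metricBl X Y Z : g (X - Y) Z = g X Z - g Y Z.
Proof. by rewrite metricDl metricNl. Qed.
Lemma metric_sumr (I : finType) (F : I -> V) Z :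
  g (\sum_i F i) Z = \sum_i g (F i) Z.
Proof.
apply: (big_morph (g^~ Z)); last exact: metric0l.
by move=> X Y; rewrite metricDl.
Qed.
Lemma metricDr X Y Z : g Z (X + Y) = g Z X + g Z Y.
Proof. by rewrite Defs.metric_sym metricDl !(Defs.metric_sym _ Z). Qed.
Lemma metricNr X Z : g Z (- X) = - g Z X.
Proof. by rewrite Defs.metric_sym metricNl !(Defs.metric_sym _ Z). Qed.
Lemma metricBr X Y Z : g Z (X - Y) = g Z X - g Z Y.
Proof. by rewrite metricDr metricNr. Qed.

Lemma metric_eq0 X : g X X = 0 -> X = 0.
Proof.
move=> gX; apply: vfP => f; apply: cinftyP => p.
have [Xp|nXp] := pselect (vanishes_at X p); first exact: Xp.
by have := metric_pos g nXp; rewrite gX ltxx.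
Qed.

Lemma metric_inj X X' : (forall Y, g X Y = g X' Y) -> X = X'.
Proof.
move=> XX'; apply/eqP; rewrite -subr_eq0; apply/eqP/metric_eq0.
by rewrite metricBl XX' subrr.
Qed.

Variable nabla : V -> V -> V.
Hypothesis lc : levi_civita g nabla.

Lemma nablaDl X Y Z : nabla (X + Y) Z = nabla X Z + nabla Y Z.
Proof. by have := nabla_linearl lc 1 X Y Z; rewrite !scale1r. Qed.
Lemma nabla0l Z : nabla 0 Z = 0.
Proof. by apply: (addIr (nabla 0 Z)); rewrite -nablaDl addr0 add0r. Qed.
Lemma nablaNl X Z : nabla (- X) Z = - nabla X Z.
Proof. by have := nabla_linearl lc (-1) X 0 Z; rewrite nabla0l !addr0 !scaleN1r. Qed.
Lemma nablaBl X Y Z : nabla (X - Y) Z = nabla X Z - nabla Y Z.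
Proof. by rewrite nablaDl nablaNl. Qed.
Lemma nabla0r Z : nabla Z 0 = 0.
Proof. by apply: (addIr (nabla Z 0)); rewrite -(nabla_addr lc) addr0 add0r. Qed.
Lemma nablaNr X Z : nabla Z (- X) = - nabla Z X.
Proof. by apply/eqP; rewrite -addr_eq0 -(nabla_addr lc) addNr nabla0r. Qed.
Lemma nablaBr X Y Z : nabla Z (X - Y) = nabla Z X - nabla Z Y.
Proof. by rewrite (nabla_addr lc) nablaNr. Qed.

Local Notation Rm := (curvature nabla).

Lemma curvatureC X Y Z : Rm X Y Z = - Rm Y X Z.
Proof.
rewrite /curvature (lieC X Y) nablaNl opprK; apply: vfP => f.
by rewrite !vfieldE; ring.
Qed.

(** The commutator of [X] and [Y] minus [lie X Y] kills the function [g Z W]; metric compatibility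
    expands this into the two curvature terms. *)
Lemma curvature_skew X Y Z W : g (Rm X Y Z) W = - g (Rm X Y W) Z.
Proof.
have : X (Y (g Z W)) - Y (X (g Z W)) - lie X Y (g Z W) = 0 by rewrite subrr.
rewrite !(nabla_metric lc) !vfieldD !(nabla_metric lc) /curvature !metricBl.
rewrite !(Defs.metric_sym g Z) => E.
by apply/eqP; rewrite -subr_eq0 -[X in _ == X]E; apply/eqP; ring.
Qed.

(** The right-hand [0] is replaced by the Jacobi sum; torsion-freeness then turns every bracket into
    covariant derivatives, and the two sides agree. *)
Lemma bianchi X Y Z : Rm X Y Z + Rm Y Z X + Rm Z X Y = 0.
Proof.
have tor U W : nabla U W = nabla W U + lie U W.
  by rewrite -(nabla_torsion_free lc) addrC subrK.
rewrite -(lie_jacobi X Y Z) /curvature.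
rewrite -!(nabla_torsion_free lc) !nablaBr !nablaBl.
apply: vfP => f.
by rewrite !vfieldE; ring.
Qed.
End Riemannian.

(** * Weak K-contact manifolds *)

Section WeakKContact.
Variables (R : realType) (n : nat) (M : manifold R (2 * n).+1).
Local Notation C := (cinfty M).
Local Notation V := (vfield M).
Variables (phi Q : {linear V -> V}) (xi : V) (eta : {linear V -> C | *%R}).
Variables (g : metric M) (nabla : V -> V -> V).

(** * Consequences of the almost contact metric identities *)

Section AlmostContactMetric.
Hypothesis wac : weak_almost_contact phi Q xi eta.

(* [Z = phi xi] satisfies [phi Z = 0], so [Q Z = eta Z *: xi = Q (eta Z *: xi)] and
   [Z = eta Z *: xi]; then [0 = phi Z = (eta Z)^2 *: xi]. *)
Lemma phi_xi : phi xi = 0.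
Proof.
set Z := phi xi.
have phiZ : phi Z = 0.
  by rewrite /Z (wac_phi2 wac) (wac_Q_xi wac) (wac_eta_xi wac) scale1r addNr.
have QZ : Q Z = Q (eta Z *: xi).
  rewrite linearZ/= (wac_Q_xi wac); apply/eqP; rewrite -subr_eq0 -oppr_eq0 opprB.
  by rewrite addrC -(wac_phi2 wac) phiZ linear0.
have ZE : Z = eta Z *: xi := bij_inj (wac_Q_nonsingular wac) QZ.
have etaZ2 : eta Z * eta Z = 0.
  have : eta (eta Z *: Z) = eta Z * eta Z by exact: linearZ.
  move=> <-; rewrite [X in eta X](_ : _ = 0) ?linear0//.
  by rewrite -[RHS]phiZ [in RHS]ZE linearZ.
have etaZ : eta Z = 0.
  apply: cinftyP => p; have /(congr1 (fun f : C => f p)) := etaZ2.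
  by rewrite !cinftyE => /eqP; rewrite mulf_eq0 orbb => /eqP.
by rewrite ZE etaZ scale0r.
Qed.

Hypothesis gQ : forall X Y, g (phi X) (phi Y) = g X (Q Y) - eta X * eta Y.

(** This is the compatibility of [g] with [phi] at [Y = xi], where [phi xi = 0]. *)
Lemma eta_metric X : eta X = g X xi.
Proof.
have := gQ X xi; rewrite phi_xi (wac_Q_xi wac) (wac_eta_xi wac) mulr1.
by rewrite Defs.metric_sym metric0l => /eqP; rewrite eq_sym subr_eq0 => /eqP.
Qed.

(** Both [g (phi X) (phi Y)] and [eta X * eta Y] are symmetric in [X, Y]. Basis independence of the
    trace of [Q] rests on this. *)
Lemma Q_selfadjoint X Y : g (Q X) Y = g X (Q Y).
Proof.
have := gQ X Y; rewrite Defs.metric_sym gQ Defs.metric_sym mulrC.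
by move=> /eqP; rewrite (inj_eq (addIr _)) => /eqP.
Qed.

End AlmostContactMetric.

Hypothesis wK : weak_K_contact phi Q xi eta g.
Hypothesis lc : levi_civita g nabla.

Let wcm := wK_wcm wK.
Let wacm := wcm_wacm wcm.
Let wac := wacm_wac wacm.
Let gQ := wacm_metric wacm.

(** The form [d eta] is alternating and equals [g X (phi Y)]. *)
Lemma phi_skew X Y : g (phi X) Y = - g X (phi Y).
Proof.
rewrite Defs.metric_sym !(wcm_dPhi wcm) /ext_d (lieC X Y) linearN.
by apply: cinftyP => p; rewrite !cinftyE; ring.
Qed.

(** Since [eta X = g X xi], the Killing equation makes [g (nabla X xi) Y] skew in [X, Y], and
    [Phi = d eta] identifies its skew part with [g X (phi Y)]. *)
Lemma nabla_reeb X : nabla X xi = - phi X.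
Proof.
apply: (@metric_inj _ _ _ g) => Y; rewrite metricNl phi_skew opprK.
apply: cinftyP => p.
have /(congr1 (fun f : C => f p)) := wcm_dPhi wcm X Y.
have /(congr1 (fun f : C => f p)) := wK_killing wK X Y.
rewrite /ext_d /lie_metric !(eta_metric wac gQ) -!(nabla_torsion_free lc).
rewrite !(nabla_metric lc) !metricBl !metricBr !cinftyE.
rewrite (Defs.metric_sym g Y (nabla X xi)).
by lra.
Qed.

Local Notation Rm := (curvature nabla).

Lemma curvature_reeb X Y :
  Rm X Y xi = nabla_endo nabla phi Y X - nabla_endo nabla phi X Y.
Proof.
rewrite /curvature /nabla_endo !nabla_reeb !(nablaNr lc) -(nabla_torsion_free lc).
rewrite linearB/=; apply: vfP => f.
by rewrite !vfieldE; ring.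
Qed.

(** Differentiate [g (phi Y) Z = - g Y (phi Z)] along [X]. *)
Lemma nabla_phi_skew X Y Z :
  g (nabla_endo nabla phi X Y) Z = - g (nabla_endo nabla phi X Z) Y.
Proof.
rewrite /nabla_endo !metricBl !phi_skew opprK.
have : X (g (phi Y) Z) = - X (g Y (phi Z)).
  by rewrite phi_skew -scaleN1r vfield_cst scaleN1r.
rewrite !(nabla_metric lc) (Defs.metric_sym g Y) (Defs.metric_sym g (phi Y)) => E.
by apply: cinftyP => p; move: E => /(congr1 (fun f : C => f p)); rewrite !cinftyE; lra.
Qed.

(** This is the closedness of [Phi]. Paired with [xi], each term of the Bianchi sum is, by skewness,
    the sum of two consecutive terms of the cyclic sum, so the Bianchi sum is twice the cyclic
    one. *)
Lemma nabla_phi_cyclic X Y Z :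
  g (nabla_endo nabla phi X Y) Z + g (nabla_endo nabla phi Y Z) X
    + g (nabla_endo nabla phi Z X) Y = 0.
Proof.
have E U W T : g (Rm U W T) xi =
    - g (nabla_endo nabla phi U T) W - g (nabla_endo nabla phi W U) T.
  rewrite (curvature_skew lc) curvature_reeb metricBl opprB addrC.
  by rewrite (nabla_phi_skew U W) addrC.
have : g (Rm X Y Z + Rm Y Z X + Rm Z X Y) xi = g 0 xi by rewrite (bianchi lc).
rewrite metricDl [g (Rm X Y Z + _) _]metricDl !E metric0l => {}E.
rewrite (nabla_phi_skew X) (nabla_phi_skew Y) (nabla_phi_skew Z); apply: cinftyP => p.
by move: E => /(congr1 (fun f : C => f p)); rewrite !cinftyE; lra.
Qed.

Lemma curvature_reeb_nabla_phi X Y : Rm xi X Y = nabla_endo nabla phi X Y.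
Proof.
apply: (@metric_inj _ _ _ g) => Z; apply: cinftyP => p.
(* Pair symmetry moves [xi] to the third slot, where [curvature_reeb] applies; skewness and the
   cyclic sum then merge its two terms into one. *)
rewrite (@pair_symmetry R V (fun X Y Z W => g (Rm X Y Z) W p)).
- rewrite curvature_reeb metricBl.
  have /(congr1 (fun f : C => f p)) := nabla_phi_cyclic X Y Z.
  have /(congr1 (fun f : C => f p)) := nabla_phi_skew Z X Y.
  by rewrite !cinftyE; lra.
- by move=> *; rewrite (curvatureC lc) metricNl.
- by move=> *; rewrite (curvature_skew lc).
- by move=> U W T S; rewrite -!cinftyDE -!metricDl (bianchi lc) metric0l.
Qed.

Lemma curvature_reeb_reeb X : Rm X xi xi = - phi (phi X).
Proof.
(* The term [(nabla_xi phi) X] becomes [Rm xi xi X], which vanishes; as [phi xi = 0], the other one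
   is [- phi (nabla X xi)]. *)
rewrite curvature_reeb -curvature_reeb_nabla_phi /nabla_endo (phi_xi wac) (nabla0r lc).
rewrite nabla_reeb linearN opprK add0r.
have lie0 : lie xi xi = 0 by apply: vfP => f /=; rewrite subrr.
by rewrite [X in X - _](_ : _ = 0) ?sub0r// /curvature subrr lie0 (nabla0l lc) subr0.
Qed.

End WeakKContact.

(** * Smooth functions on a Euclidean space *)

Section Lines.
Variables (R : realType) (V W : normedModType R).

Lemma is_derive_line (f : V -> W) (x v : V) (t : R) :
  derivable f (x + t *: v) v ->
  is_derive t 1 (fun s : R => f (x + s *: v)) ('D_v f (x + t *: v)).
Proof.
pose fl (s : R) := f (x + s *: v).
have E : (fun h : R => h^-1 *: ((fl \o shift t) (h *: 1) - fl t))
       = (fun h : R => h^-1 *: ((f \o shift (x + t *: v)) (h *: v) - f (x + t *: v))).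
  apply/funext => h; rewrite /fl /=; congr (_ *: (f _ - _)).
  by rewrite [h%:A]mulr1 scalerDl addrCA.
by move=> df; split; rewrite -/fl /derivable /derive E.
Qed.

Lemma derive_lineE (f : V -> W) (x v : V) :
  'D_v f x = 'D_1 (fun s : R => f (s *: v + x)) 0.
Proof.
rewrite /derive/=.
rewrite (_ : (fun h : R => h^-1 *: (f ((h *: (1 : R) + 0) *: v + x) - f (0 *: v + x))) =
   (fun h : R => h^-1 *: (f (h *: v + x) - f x)))//.
by apply/funext => h; rewrite addr0 scale0r add0r [h%:A]mulr1.
Qed.

End Lines.

Section LineMVT.
Variables (R : realType) (V : normedModType R).

Lemma line_MVT (f : V -> R) (x v : V) (c : R) (B : set V) :
  (forall t, 0 <= t <= 1 -> B (x + (t * c) *: v)) ->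
  (forall y, B y -> derivable f y v) ->
  exists2 y, B y & f (x + c *: v) - f x = c * 'D_v f y.
Proof.
(* For negative [c] the segment is traversed from its other end. *)
wlog c0 : x c / 0 <= c => [wlg Bx df|Bx df].
  have [c0|c0] := leP 0 c; first exact: wlg.
  have [||y By yE] := wlg (x + c *: v) (- c) _ _ df.
  - by rewrite oppr_ge0 ltW.
  - move=> t /andP[t0 t1]; rewrite -addrA -scalerDl.
    have -> : c + t * - c = (1 - t) * c by ring.
    by apply: Bx; rewrite subr_ge0 t1 lerBlDr lerDl.
  - exists y => //; move: yE; rewrite -addrA -scalerDl subrr scale0r addr0 mulNr.
    by move=> /(congr1 -%R); rewrite opprB opprK.
have Bt t : t \in `[0, c] -> B (x + t *: v).
  rewrite in_itv/= => /andP[t0 tc]; have [c_eq0|c_neq0] := eqVneq c 0.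
    have -> : t = 0 * c by rewrite mul0r; apply/le_anti; rewrite t0 andbT -c_eq0.
    by apply: Bx; rewrite lexx ler01.
  have c_gt0 : 0 < c by rewrite lt0r c_neq0.
  rewrite -(divfK c_neq0 t); apply: Bx.
  by rewrite divr_ge0//= ler_pdivrMr// mul1r.
have dI t : t \in `[0, c] ->
    is_derive t 1 (fun s => f (x + s *: v)) ('D_v f (x + t *: v)).
  by move=> tI; exact: is_derive_line (df _ (Bt _ tI)).
have [t tI E] := @MVT_segment R (fun t => f (x + t *: v))
  (fun t => 'D_v f (x + t *: v)) 0 c c0
  (fun t tI => dI t (subset_itv_oo_cc tI))
  (derivable_within_continuous (fun t tI => @ex_derive _ _ _ _ _ _ _ (dI t tI))).
exists (x + t *: v); first exact: Bt.
by move: E; rewrite scale0r addr0 subr0 mulrC.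
Qed.

End LineMVT.

Lemma differentiable_littleo (R : realType) (V W : normedModType R) (f : V -> W)
    (L : {linear V -> W}) (x : V) :
  continuous L ->
  (forall e, 0 < e -> \forall h \near 0, `|f (h + x) - f x - L h| <= e * `|h|) ->
  differentiable f x.
Proof.
move=> cL H; apply/diff_locallyP.
suff E : f \o shift x = cst (f x) + L +o_ 0 id.
  by rewrite (diff_unique cL E).
apply/eqaddoP => e e0; near=> h.
rewrite /= opprD addrA; near: h; exact: H.
Unshelve. all: end_near. Qed.

Section RowNorm.
Variables (R : realType) (m : nat).
Implicit Types v : 'rV[R]_m.

Lemma rV_norm_le v (e : R) : 0 <= e -> (forall i, `|v 0 i| <= e) -> `|v| <= e.
Proof.
move=> e0 ve; rewrite [leLHS]/Num.Def.normr/= mx_normrE bigmax_le//= => -[i j] _ /=.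
by rewrite ord1.
Qed.

Lemma rV_norm_lt v (e : R) : 0 < e -> (forall i, `|v 0 i| < e) -> `|v| < e.
Proof.
move=> e0 ve; rewrite [ltLHS]/Num.Def.normr/= mx_normrE; apply/bigmax_ltP.
by split=> // -[i j] _ /=; rewrite ord1.
Qed.

Lemma rV_coord_le v i : `|v 0 i| <= `|v|.
Proof.
by rewrite [leRHS]/Num.Def.normr/= mx_normrE; exact: (le_bigmax _ _ (0, i)).
Qed.

Lemma rV_continuous (T : topologicalType) (F : T -> 'rV[R]_m) x :
  (forall i, {for x, continuous (fun y => F y 0 i)}) -> {for x, continuous F}.
Proof.
move=> cF; apply/cvgrPdist_lt => e e0; near=> y.
apply: rV_norm_lt => // i; rewrite !mxE; move: i; near: y.
by apply: filter_forall => i; have /cvgrPdist_lt/(_ _ e0) := cF i.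
Unshelve. all: end_near. Qed.

End RowNorm.

Section Partials.
Variables (R : realType) (m : nat).
Implicit Types (U : set 'rV[R]_m) (f : 'rV[R]_m -> R).

Let trunc (h : 'rV[R]_m) (k : nat) : 'rV[R]_m :=
  \row_(i < m) (if (i < k)%N then h 0 i else 0).

Let trunc0 h : trunc h 0 = 0.
Proof. by apply/rowP => i; rewrite !mxE. Qed.

Let truncm h : trunc h m = h.
Proof. by apply/rowP => i; rewrite !mxE ltn_ord. Qed.

Let truncS h (i : 'I_m) : trunc h i.+1 = trunc h i + h 0 i *: delta_mx 0 i.
Proof.
apply/rowP => j; rewrite !mxE eqxx/= ltnS leq_eqVlt.
have [->|ji] := eqVneq j i; first by rewrite eqxx ltnn/= mulr1 add0r.
rewrite (_ : (nat_of_ord j == i) = false) ?orFb; last exact/negbTE.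
by rewrite mulr0 addr0.
Qed.

(* Telescoping along the truncations of the increment reduces the claim to the mean
   value theorem on segments parallel to the axes. *)
Lemma Ck1_differentiable U f x : open U -> Ck 1 U f -> U x -> differentiable f x.
Proof.
move=> oU [_ df] Ux.
pose L (h : 'rV[R]_m) := \sum_i h 0 i * 'D_(delta_mx 0 i) f x.
have linL : linear L.
  move=> a h k; rewrite /L scaler_sumr -big_split/=; apply: eq_bigr => i _.
  by rewrite !mxE mulrDl -mulrA.
pose LL : {linear 'rV[R]_m -> R} := HB.pack L (GRing.isLinear.Build _ _ _ _ L linL).
apply: (@differentiable_littleo _ _ _ f LL).
  rewrite -[X in continuous X]/(fun h : 'rV[R]_m =>
    \sum_i h 0 i * 'D_(delta_mx 0 i) f x).
  apply: continuous_big => [|i _ h].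
    exact: (@pseudometric_normed_Zmodule.add_continuous R R).
  apply: (@continuousM _ _ (fun h : 'rV[R]_m => h 0 i) (cst _)).
    exact: coord_continuous.
  exact: cst_continuous.
move=> e e0 /=.
(* Each of the [m] coordinate increments may contribute [d] times the norm of [h]; the denominator
   [m.+1] stays nonzero for [m = 0]. *)
pose d := e / m.+1%:R.
have d0 : 0 < d by rewrite divr_gt0.
pose B := [set y | U y /\
  forall i, `|'D_(delta_mx 0 i) f y - 'D_(delta_mx 0 i) f x| <= d].
have : nbhs x B.
  apply: filterI; first exact: open_nbhs_nbhs (conj oU Ux).
  apply: (@filter_forall _ _ (fun i y =>
    `|'D_(delta_mx 0 i) f y - 'D_(delta_mx 0 i) f x| <= d) (nbhs x)) => i.
  have [_ [ci _]] := df i.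
  have /cvgrPdist_le/(_ _ d0) := ci x Ux.
  by apply: filterS => y; rewrite distrC.
move=> /nbhs_normP[r /= r0 xr].
apply/nbhs_normP; exists r => // h /=; rewrite sub0r normrN => hr.
pose c (i : 'I_m) := f (x + trunc h i.+1) - f (x + trunc h i).
have -> : f (h + x) - f x = \sum_(i < m) c i.
  rewrite -(big_mkord xpredT (fun k => f (x + trunc h k.+1) - f (x + trunc h k))).
  by rewrite telescope_sumr// trunc0 truncm addr0 [h + x]addrC.
rewrite /L -sumrB (le_trans (ler_norm_sum _ _ _))//.
suff ci i : `|c i - h 0 i * 'D_(delta_mx 0 i) f x| <= d * `|h|.
  rewrite (le_trans (ler_sum _ (fun i _ => ci i)))//.
  rewrite sumr_const card_ord -mulr_natl mulrA ler_wpM2r// /d mulrCA ger_pMr//.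
  by rewrite ler_pdivrMr// mul1r ler_nat.
rewrite /c truncS addrA.
have [||y [_ /(_ i) By] ->] := @line_MVT _ _ f (x + trunc h i) (delta_mx 0 i) (h 0 i) B.
(* In the maximum norm, truncating [h] or shrinking one of its coordinates does not increase its
   length, so the segment stays in the ball. *)
- move=> t /andP[t0 t1]; apply: xr => /=; rewrite -addrA opprD addNKr normrN.
  apply: le_lt_trans hr; apply: rV_norm_le => // j; rewrite !mxE eqxx/=.
  have [->|ji] := eqVneq j i.
    rewrite ltnn add0r mulr1 normrM ger0_norm// (le_trans _ (rV_coord_le _ i))//.
    exact: ler_piMl.
  rewrite mulr0 addr0; case: ifP => _; first exact: rV_coord_le.
  by rewrite normr0.
- by move=> y [Uy _]; have [/(_ _ Uy)] := df i.
by rewrite -mulrBr normrM mulrC ler_pM// rV_coord_le.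
Qed.

End Partials.

Lemma Ck_sum (R : realType) m k (U : set 'rV[R]_m) (I : Type) (r : seq I)
    (P : pred I) (F : I -> 'rV[R]_m -> R) :
  open U -> (forall i, P i -> Ck k U (F i)) -> Ck k U (\sum_(i <- r | P i) F i).
Proof.
move=> oU CF; elim/big_ind: _ => //; first exact: (Ck_cst k U 0).
by move=> f g; exact: CkD.
Qed.

(** * The chain rule and stability of smoothness under composition *)

Section Composition.
Variables (R : realType) (m n : nat).
Implicit Types (f : 'rV[R]_n -> R) (F : 'rV[R]_m -> 'rV[R]_n).

Lemma differentiable_deriveE f (x v : 'rV[R]_n) : differentiable f x ->
  'D_v f x = \sum_j v 0 j * 'D_(delta_mx 0 j) f x.
Proof.
move=> df; rewrite deriveE// [v in LHS]row_sum_delta linear_sum.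
by apply: eq_bigr => j _; rewrite linearZ/= -deriveE.
Qed.

(** As [F] is only derivable along [v], the chain rule is applied to the curve [c], which is
    differentiable at [0] as a function of one variable. *)
Lemma is_derive_comp_row (V : normedModType R) (F : V -> 'rV[R]_n) f (x v : V) :
  differentiable f (F x) ->
  (forall j, derivable (fun y => F y 0 j) x v) ->
  is_derive x v (f \o F)
    (\sum_j 'D_v (fun y => F y 0 j) x * 'D_(delta_mx 0 j) f (F x)).
Proof.
move=> df dF.
have dFx : derivable F x v by apply/derivable_mxP => i j; rewrite ord1.
pose c (s : R) := F (s *: v + x).
have c0 : c 0 = F x by rewrite /c scale0r add0r.
have dc : differentiable c 0.
  by apply/derivable1_diffP; exact: ((derivable1P F x v).1 dFx).
have dfc : differentiable (f \o c) 0 by apply: differentiable_comp; rewrite ?c0.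
have E : derivable (f \o F) x v.
  by apply/derivable1P; exact: (derivable1_diffP (f \o c) 0).2 dfc.
split=> //; rewrite derive_lineE deriveE// (diff_comp dc); last by rewrite c0.
have dcE : 'd c 0 1 = 'D_v F x by rewrite -deriveE// [RHS]derive_lineE.
rewrite /= c0 dcE -deriveE// differentiable_deriveE//.
by apply: eq_bigr => j _; rewrite derive_mx// mxE.
Qed.

(** By induction on [k]: the partial derivatives of [f \o F] are sums of products of partials of [F]
    with partials of [f] composed with [F]. *)
Lemma Ck_comp k (U : set 'rV[R]_m) (V : set 'rV[R]_n) f F :
  open U -> open V -> (forall x, U x -> V (F x)) ->
  Ck k V f -> (forall j, Ck k U (fun x => F x 0 j)) -> Ck k U (f \o F).
Proof.
move=> oU oV UV; elim: k f => [|k IH] f Cf CF.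
all: have cfF x (Ux : U x) : {for x, continuous (f \o F)}
  by apply: continuous_comp; [apply: rV_continuous => j; exact: Ck_continuous (CF j) _ Ux
    |exact: Ck_continuous Cf _ (UV _ Ux)].
  by split.
split=> // i.
have Cf1 : Ck 1 V f by elim: (k) Cf => // l IHl /CkW.
have dc x : U x -> is_derive x (delta_mx 0 i) (f \o F)
    (\sum_j 'D_(delta_mx 0 i) (fun y => F y 0 j) x * 'D_(delta_mx 0 j) f (F x)).
  move=> Ux; apply: is_derive_comp_row => [|j].
    exact: Ck1_differentiable oV Cf1 (UV _ Ux).
  by have [_ /(_ i)[/(_ _ Ux)]] := CF j.
split=> [x Ux|]; first by have [] := dc _ Ux.
apply: (@eq_Ck _ _ _ _ (\sum_j ((fun x => 'D_(delta_mx 0 i) (fun y => F y 0 j) x) *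
   ('D_(delta_mx 0 j) f \o F)))) => //.
  by move=> x Ux; have [_ ->] := dc _ Ux; rewrite fct_sumE.
apply: Ck_sum => // j _; apply: CkM => //; first by have [_ /(_ i)[]] := CF j.
apply: IH => [|l]; last exact: CkW.
by have [_ /(_ j)[]] := Cf.
Qed.

End Composition.

Section ScalarComposition.
Variables (R : realType).

Lemma is_derive_scalar_comp (V : normedModType R) (u : V -> R) (h : R -> R) (dh : R)
    (x v : V) :
  derivable u x v -> is_derive (u x) 1 h dh ->
  is_derive x v (h \o u) (dh * 'D_v u x).
Proof.
move=> du [hd <-].
pose c (s : R) := u (s *: v + x).
have c0 : c 0 = u x by rewrite /c scale0r add0r.
have dc : derivable c 0 1 by exact: ((derivable1P u x v).1 du).
have dhc : derivable (h \o c) 0 1.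
  apply/derivable1_diffP/differentiable_comp; first exact/derivable1_diffP.
  by rewrite c0; exact/derivable1_diffP.
split; first exact/derivable1P.
rewrite (derive_lineE (h \o u)) (derive_lineE u) -!derive1E.
by rewrite [LHS](derive1_comp dc) ?c0.
Qed.

(** The family [h] is closed under derivation, [D] giving the index of the derivative, so the
    induction on [k] runs over all indices at once. *)
Lemma Ck_scalar_comp (m : nat) (I : Type) (h : I -> R -> R) (D : I -> I) :
  (forall i (s : R), is_derive s 1 (h i) (h (D i) s)) ->
  forall k (U : set 'rV[R]_m) u i, open U -> Ck k U u -> Ck k U (h i \o u).
Proof.
move=> dh k U u i oU; elim: k i => [|k IH] i Cu.
all: have chu x (Ux : U x) : {for x, continuous (h i \o u)}
  by apply: continuous_comp; [exact: Ck_continuous Cu _ Ux|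
    apply/differentiable_continuous/derivable1_diffP; have [] := dh i (u x)].
  by split.
split=> // l; have [_ /(_ l)[du Cdu]] := Cu.
have dc x : U x -> is_derive x (delta_mx 0 l) (h i \o u)
    (h (D i) (u x) * 'D_(delta_mx 0 l) u x).
  by move=> Ux; apply: is_derive_scalar_comp; exact: du.
split=> [x Ux|]; first by have [] := dc _ Ux.
apply: (@eq_Ck _ _ _ _ ((h (D i) \o u) * (fun x => 'D_(delta_mx 0 l) u x))) => //.
  by move=> x Ux; have [_ ->] := dc _ Ux.
by apply: CkM => //; apply: IH; exact: CkW.
Qed.

End ScalarComposition.

(** * Bump functions and Hadamard's lemma *)

Section FlatFunctions.
Variable R : realType.
Implicit Types (P : {poly R}) (s : R).

(** For [P = 1] this is the classical smooth function flat at [0]; the polynomial absorbs the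
    factors produced by derivation. *)
Definition flat P s : R := if 0 < s then P.[s^-1] * expR (- s^-1) else 0.

Lemma flat_le0 P s : s <= 0 -> flat P s = 0.
Proof. by rewrite /flat leNgt; case: ltP. Qed.

Lemma flat1_gt0 s : 0 < s -> 0 < flat 1 s.
Proof. by move=> s0; rewrite /flat s0 hornerC mul1r expR_gt0. Qed.

(** With [y = 1/s], each monomial satisfies [y^i exp(-y) <= (i+1)!/y], because
    [exp y >= y^(i+1)/(i+1)!]. *)
Lemma flat_bound P : exists2 K, 0 <= K & forall s, 0 < s -> `|flat P s| <= K * s.
Proof.
exists (\sum_(i < size P) `|P`_i| * i.+1`!%:R).
  by apply: sumr_ge0 => i _; rewrite mulr_ge0.
move=> s s0; rewrite /flat s0 horner_coef mulr_suml (le_trans (ler_norm_sum _ _ _))//.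
rewrite mulr_suml ler_sum// => i _.
rewrite -mulrA normrM -[leRHS]mulrA ler_wpM2l//.
have y0 : 0 < s^-1 by rewrite invr_gt0.
rewrite ger0_norm; last by rewrite mulr_ge0 ?expR_ge0 ?exprn_ge0// ltW.
rewrite expRN ler_pdivrMr ?expR_gt0//.
have : s^-1 ^+ i.+1 / i.+1`!%:R <= expR s^-1.
  by rewrite (le_trans _ (expR_ge1Dxn i (ltW y0)))// lerDr.
rewrite ler_pdivrMr ?ltr0n ?fact_gt0// => H.
rewrite [leRHS](_ : _ = s * (expR s^-1 * i.+1`!%:R)); last by ring.
by rewrite -ler_pdivrMl// -exprS.
Qed.

(* The functions [P(1/s) exp(-1/s)] are closed under derivation. *)
Lemma is_derive_flat P s : is_derive s 1 (flat P) (flat ('X^2 * (P - P^`())) s).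
Proof.
have [s0|s0|<-] := ltgtP 0 s.
- apply: (@near_eq_is_derive _ _ _ (fun s => P.[s^-1] * expR (- s^-1))).
    near=> t; rewrite /flat ifT//; near: t; exact: lt_nbhsr.
  have dV : is_derive s 1 (fun t : R => t^-1) (- s ^- 2).
    split; first by apply: derivableV => //; rewrite gt_eqF.
    by rewrite deriveV ?gt_eqF// derive_id [LHS]mulr1.
  have dP : is_derive (s^-1) 1 (horner P) P^`().[s^-1].
    by split; [exact: derivable_horner|rewrite derivE derive1E].
  have dN : is_derive s 1 (fun t : R => - t^-1) (s ^- 2).
    by rewrite -[s ^- 2]opprK; exact: is_deriveN.
  have dPV : is_derive s 1 (fun t : R => P.[t^-1]) (P^`().[s^-1] * - s ^- 2).
    exact: (@is_derive1_comp _ (horner P) GRing.inv).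
  have dEN : is_derive s 1 (fun t : R => expR (- t^-1)) (expR (- s^-1) * s ^- 2).
    exact: (@is_derive1_comp _ expR (fun t => - t^-1)).
  apply: (is_derive_eq (is_deriveM dPV dEN)).
  rewrite /flat s0 hornerM hornerXn hornerD hornerN /GRing.scale/=.
  by rewrite exprVn; ring.
- apply: (@near_eq_is_derive _ _ _ (cst 0)).
    near=> t; rewrite flat_le0//; apply/ltW; near: t; exact: lt_nbhsl.
  by rewrite flat_le0 ?ltW//; exact: is_derive_cst.
(* At [0] the difference quotient of [flat P] is [flat ('X * P)], which the linear bound sends to
   [0]. *)
have [K K0 HK] := flat_bound ('X * P).
rewrite flat_le0//.
suff H : h^-1 *: (flat P (h *: 1 + 0) - flat P 0) @[h --> (0:R)^'] --> (0 : R).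
  by split; [apply/cvg_ex; exists 0|exact/cvg_lim].
apply/cvgrPdist_le => e e0; near=> h.
have h0 : h != 0 by near: h; exact: nbhs_dnbhs_neq.
rewrite [h *: 1]mulr1 addr0 (flat_le0 P (lexx 0)) subr0 sub0r normrN.
have [hp|hn] := ltP 0 h; last by rewrite flat_le0// scaler0 normr0 ltW.
have -> : h^-1 *: flat P h = flat ('X * P) h.
  by rewrite /flat hp hornerM hornerX; exact: mulrA.
rewrite (le_trans (HK h hp))//.
(* Since [K] may be [0], the division is by [K + 1]. *)
rewrite (le_trans (ler_wpM2r (ltW hp) (_ : K <= K + 1)))// ?lerDl//.
rewrite mulrC -ler_pdivlMr ?ltr_wpDl// ltW//.
rewrite -[ltLHS](ger0_norm (ltW hp)); near: h; apply: dnbhs0_lt.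
by rewrite divr_gt0// ltr_wpDl.
Unshelve. all: end_near.
Qed.

End FlatFunctions.

(** * Bump functions *)

Section Bump.
Variables (R : realType) (m : nat).
Implicit Types (U : set 'rV[R]_m).

Lemma Ck_prod k U (I : Type) (r : seq I) (P : pred I) (F : I -> 'rV[R]_m -> R) :
  open U -> (forall i, P i -> Ck k U (F i)) -> Ck k U (\prod_(i <- r | P i) F i).
Proof.
move=> oU CF; elim/big_ind: _ => //; first exact: (Ck_cst k U 1).
by move=> f g; exact: CkM.
Qed.

Lemma Ck_coord k U i : Ck k U (fun x => x 0 i).
Proof.
case: k => [|k]; (split; first by move=> x _; exact: coord_continuous) => //.
have d x v : is_derive x v (fun y : 'rV[R]_m => y 0 i) (v 0 i).
  split; first by have /derivable_mxP := @derivable_id _ _ x v; exact.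
  have := derive_mx (@derivable_id _ _ x v); rewrite derive_id => /matrixP/(_ 0 i).
  by rewrite mxE => /esym.
move=> j; split=> [x _|]; first by have [] := d x (delta_mx 0 j).
have -> : (fun x => 'D_(delta_mx 0 j) (fun y : 'rV[R]_m => y 0 i) x)
    = cst ((delta_mx 0 j : 'rV[R]_m) 0 i).
  by apply/funext => x; have [_ ->] := d x (delta_mx 0 j).
exact: Ck_cst.
Qed.

(** A ball of the maximum norm is a cube, so a product over the coordinates suffices: the two
    factors of index [i] vanish unless [x 0 i - p 0 i] lies strictly between [- r] and [r]. *)
Lemma bump_exists (p : 'rV[R]_m) (r : R) : 0 < r ->
  exists chi : 'rV[R]_m -> R,
    [/\ forall k, Ck k setT chi, 0 < chi p & forall x, chi x != 0 -> `|x - p| < r].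
Proof.
move=> r0; pose u (s : R) i (x : 'rV[R]_m) := r + s * (x 0 i - p 0 i).
pose chi := \prod_i ((flat 1 \o u 1 i) * (flat 1 \o u (-1) i)).
have chiE x : chi x = \prod_i (flat 1 (u 1 i x) * flat 1 (u (-1) i x)).
  by rewrite /chi fct_prodE.
have Cu k s i : Ck k setT (u s i).
  have := CkD openT (Ck_cst k setT r)
    (CkM openT (Ck_cst k setT s)
      (CkD openT (Ck_coord k setT i) (Ck_cst k setT (- p 0 i)))).
  by [].
exists chi; split.
- move=> k; apply: Ck_prod => [|i _]; first exact: openT.
  apply: CkM; first exact: openT.
    by apply: (Ck_scalar_comp (@is_derive_flat R)); [exact: openT|exact: Cu].
  by apply: (Ck_scalar_comp (@is_derive_flat R)); [exact: openT|exact: Cu].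
- rewrite chiE; apply: prodr_gt0 => i _.
  by rewrite /u subrr !mulr0 addr0 mulr_gt0// flat1_gt0.
move=> x; rewrite chiE prodf_seq_neq0 => /allP chi0.
apply: rV_norm_lt => // i; rewrite !mxE ltr_norml.
have := chi0 i (mem_index_enum i); rewrite mulf_eq0 negb_or /u mul1r mulN1r.
move=> /andP[H1 H2]; apply/andP; split.
  rewrite ltNge; apply: contra_neqN H1 => xp.
  by rewrite flat_le0//; lra.
rewrite ltNge; apply: contra_neqN H2 => xp.
by rewrite flat_le0//; lra.
Qed.

End Bump.

(** * Integration over the unit interval *)

Section UnitIntegral.
Variable R : realType.
Local Notation mu := (@lebesgue_measure R).
Implicit Types f g : R -> R.

Definition int01 f : R := (\int[mu]_(t in `[0%R, 1%R]) f t)%R.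

Let cont01 f := forall t : R, 0 <= t <= 1 -> {for t, continuous f}.

Let cont01_within f : cont01 f -> {within `[0, 1], continuous f}.
Proof.
move=> cf; apply: continuous_in_subspaceT => t /[!inE]/=.
by rewrite in_itv/=; exact: cf.
Qed.

Let cont01_integrable f : cont01 f -> mu.-integrable `[0%R, 1%R] (EFin \o f).
Proof.
move=> cf; apply: continuous_compact_integrable; first exact: segment_compact.
exact: cont01_within.
Qed.

Lemma int01B f g : cont01 f -> cont01 g ->
  int01 (fun t => f t - g t) = int01 f - int01 g.
Proof. by move=> cf cg; apply: RintegralB => //; exact: cont01_integrable. Qed.

Lemma int01Z f (r : R) : cont01 f -> int01 (fun t => r * f t) = r * int01 f.
Proof. by move=> cf; apply: RintegralZl => //; exact: cont01_integrable. Qed.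

(** Continuity is carried along because adding one more integral requires the rest of the sum to be
    integrable. *)
Lemma int01_sum (I : Type) (r : seq I) (F : I -> R -> R) :
  (forall i, cont01 (F i)) ->
  cont01 (fun t => \sum_(i <- r) F i t) /\
  int01 (fun t => \sum_(i <- r) F i t) = \sum_(i <- r) int01 (F i).
Proof.
move=> cF; elim: r => [|i r [cr IH]].
  under eq_fun do rewrite big_nil; rewrite big_nil; split.
    by move=> t _; exact: cst_continuous.
  by rewrite /int01 Rintegral_cst// mul0r.
under eq_fun do rewrite big_cons; rewrite big_cons; split.
  by move=> t t01; apply: (@continuousD _ _ _ (F i)); [exact: cF|exact: cr].
by rewrite -IH; apply: RintegralD => //; exact: cont01_integrable.
Qed.

Lemma int01_cst (r : R) : int01 (fun=> r) = r.
Proof.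
rewrite /int01 Rintegral_cst//= lebesgue_measure_itv/= lte_fin ltr01.
by rewrite -EFinB /= subr0 mulr1.
Qed.

Lemma int01_norm_le f (e : R) : cont01 f ->
  (forall t : R, 0 <= t <= 1 -> `|f t| <= e) -> `|int01 f| <= e.
Proof.
move=> cf fe; rewrite -[leRHS]int01_cst.
have cst01 : cont01 (fun=> e) by move=> t _; exact: cst_continuous.
apply: le_trans (le_normr_Rintegral _ _) _ => //; first exact: cont01_integrable.
have cnf : cont01 (fun t => `|f t|).
  by move=> t t01; apply: continuous_comp; [exact: cf|exact: norm_continuous].
apply: le_Rintegral => //; [exact: cont01_integrable cnf|exact: cont01_integrable cst01].
Qed.

Lemma int01_FTC f g : cont01 f ->
  (forall t : R, 0 <= t <= 1 -> is_derive t 1 g (f t)) -> int01 f = g 1 - g 0.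
Proof.
move=> cf dg; have cg : cont01 g.
  move=> t t01; have [dgt _] := dg t t01.
  exact/differentiable_continuous/derivable1_diffP.
rewrite /int01 /Rintegral (@continuous_FTC2 _ f g)//; first exact: cont01_within.
  split=> [t tI||].
  - by have [] : is_derive t 1 g (f t) by apply: dg; rewrite !ltW ?(itvP tI).
  - by apply: cvg_at_right_filter; apply: cg; rewrite lexx ler01.
  - by apply: cvg_at_left_filter; apply: cg; rewrite lexx ler01.
move=> t tI; rewrite derive1E.
by have [] : is_derive t 1 g (f t) by apply: dg; rewrite !ltW ?(itvP tI).
Qed.

End UnitIntegral.

(** * Radial means and Hadamard's lemma on an open set star-shaped about [q] *)

Section Hadamard.
Variables (R : realType) (m : nat) (q : 'rV[R]_m) (B : set 'rV[R]_m).
Hypothesis oB : open B.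
Hypothesis starB : forall x (t : R), B x -> 0 <= t <= 1 -> B (q + t *: (x - q)).
Implicit Types (f : 'rV[R]_m -> R) (x y v : 'rV[R]_m) (t : R).

Let contB f := forall x, B x -> {for x, continuous f}.

Let G j f t x : R := t ^+ j * f (q + t *: (x - q)).

(* The weight [t^j] absorbs the factor [t] that each partial derivative produces. *)
Definition radial_mean j f x : R := int01 (fun t => G j f t x).

Let G_continuous2 j f t x : contB f -> B x -> 0 <= t <= 1 ->
  {for (t, x), continuous (fun z : R * 'rV[R]_m => G j f z.1 z.2)}.
Proof.
move=> cf Bx t01; apply: (@continuousM _ _ (fun z : R * 'rV[R]_m => z.1 ^+ j)
  (fun z : R * 'rV[R]_m => f (q + z.1 *: (z.2 - q)))).
  apply: (@continuous_comp _ _ _ fst (fun t : R => t ^+ j)); first exact: cvg_fst.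
  exact: exprn_continuous.
apply: (@continuous_comp _ _ _ (fun z : R * 'rV[R]_m => q + z.1 *: (z.2 - q)) f).
  apply: cvgD; first exact: cvg_cst.
  by apply: cvgZ; [exact: cvg_fst|apply: cvgB; [exact: cvg_snd|exact: cvg_cst]].
by apply: cf; exact: starB.
Qed.

Let G_continuous j f x : contB f -> B x ->
  forall t, 0 <= t <= 1 -> {for t, continuous (fun t => G j f t x)}.
Proof.
move=> cf Bx t t01; apply: (@continuous_comp _ _ _ (fun t : R => (t, x))
  (fun z : R * 'rV[R]_m => G j f z.1 z.2)); last exact: G_continuous2.
exact: (cvg_pair cvg_id (cvg_cst x)).
Qed.

(** Joint continuity in [t] and [x], together with compactness of the unit interval, makes the
    estimate uniform in [t]. *)
Let G_unif j f x e : contB f -> B x -> 0 < e ->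
  \forall y \near x, forall t, 0 <= t <= 1 -> `|G j f t y - G j f t x| <= e.
Proof.
move=> cf Bx e0.
have /compact_near_coveringP := @segment_compact R 0 1.
move=> /(_ _ (nbhs x) (fun y t => `|G j f t y - G j f t x| <= e)) H.
have {H} : \forall y \near x, `[0, 1] `<=` (fun t => `|G j f t y - G j f t x| <= e).
  apply: H => t /=; rewrite in_itv/= => t01.
  have e2 : 0 < e / 2 by rewrite divr_gt0.
  have /cvgrPdist_lt/(_ _ e2) H1 := @G_continuous2 j f t x cf Bx t01.
  have /cvgrPdist_lt/(_ _ e2) H2 := @G_continuous j f x cf Bx t t01.
  case: H1 => /= -[V1 V2] /= [nV1 nV2] V12.
  (* Near [t], both [G j f s y] and [G j f s x] are within [e / 2] of [G j f t x]. *)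
  exists (V1 `&` [set s | `|G j f t x - G j f s x| < e / 2], V2) => /=.
    by split=> //; exact: filterI.
  move=> [s y] /= [[V1s sx] V2y].
  have /= := V12 (s, y) (conj V1s V2y) => sy.
  rewrite (splitr e) -(subrKA (G j f t x)) (le_trans (ler_normD _ _))// lerD//.
    by rewrite distrC ltW.
  by rewrite ltW.
by apply: filterS => y H t t01; apply: H; rewrite /= in_itv.
Qed.

Lemma radial_mean_continuous j f : contB f -> contB (radial_mean j f).
Proof.
move=> cf x Bx; apply/(@cvgrPdist_le _ _ _ (nbhs x)) => e e0; near=> y.
have By : B y by near: y; exact: (open_nbhs_nbhs (conj oB Bx)).
rewrite -int01B; [|exact: G_continuous..].
apply: int01_norm_le => [t t01|t t01].
  apply: (@continuousB _ _ _ (fun t => G j f t x) (fun t => G j f t y));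
  exact: G_continuous.
by rewrite distrC; move: t t01; near: y; exact: G_unif.
Unshelve. all: end_near. Qed.

(** Moving [x] by [s *: v] moves [q + t *: (x - q)] by [(t * s) *: v], whence the additional factor
    [t]. *)
Let G_derive j f v t x : (forall y, B y -> derivable f y v) -> B x -> 0 <= t <= 1 ->
  is_derive x v (G j f t) (G j.+1 ('D_v f) t x).
Proof.
move=> df Bx t01.
pose fl (s : R) := f (q + t *: (x - q) + s *: v).
have dl : is_derive (t * 0) 1 fl ('D_v f (q + t *: (x - q))).
  have := @is_derive_line _ _ _ f (q + t *: (x - q)) v (t * 0).
  by rewrite mulr0 scale0r addr0; apply; apply: df; exact: starB.
have dm : is_derive (0 : R) 1 (fun s : R => t * s) t.
  have : is_derive (0 : R) 1 (t \*: @id R) (t *: 1) by exact: is_deriveZ.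
  by rewrite [t *: 1]mulr1.
have dc : is_derive (0 : R) 1 (fun s : R => f (q + t *: (s *: v + x - q)))
   ('D_v f (q + t *: (x - q)) * t).
  have := @is_derive1_comp _ fl (fun s : R => t * s) 0 _ _ dl dm.
  congr is_derive; apply/funext => s; rewrite /fl /=; congr f.
  by rewrite -addrA -scalerA -scalerDr [x - q + _]addrC addrA.
have dfq : is_derive x v (fun x => f (q + t *: (x - q))) ('D_v f (q + t *: (x - q)) * t).
  have [d1 d2] := dc; split; first by apply/derivable1P.
  by rewrite derive_lineE.
have dG : is_derive x v (G j f t) (t ^+ j *: ('D_v f (q + t *: (x - q)) * t)).
  exact: (@is_deriveZ _ _ _ (fun x => f (q + t *: (x - q)))).
apply: is_derive_eq dG _.
by rewrite /G exprSr /GRing.scale/=; ring.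
Qed.

(** Differentiation under the integral sign: the difference quotient of the integrand is its
    derivative at an intermediate point, and [G_unif] compares this with the derivative at [x],
    uniformly in [t]. *)
Lemma radial_mean_derive j f v x : contB f -> contB ('D_v f) ->
  (forall y, B y -> derivable f y v) -> B x ->
  is_derive x v (radial_mean j f) (radial_mean j.+1 ('D_v f) x).
Proof.
move=> cf cdf df Bx.
suff H : h^-1 *: ((radial_mean j f \o shift x) (h *: v) - radial_mean j f x)
    @[h --> (0 : R)^'] --> radial_mean j.+1 ('D_v f) x.
  by split; [apply/cvg_ex; eexists; exact: H|exact/cvg_lim].
apply/cvgrPdist_le => e e0.
pose W := [set y | B y /\ forall t, 0 <= t <= 1 ->
    `|G j.+1 ('D_v f) t y - G j.+1 ('D_v f) t x| <= e].
have /nbhs_normP[r /= r0 xr] : nbhs x W.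
  apply: filterI; first exact: (open_nbhs_nbhs (conj oB Bx)).
  exact: G_unif.
have Bxh h : `|h *: v| < r -> forall t, 0 <= t <= 1 -> W (x + (t * h) *: v).
  move=> hr t /andP[t0 t1]; apply: xr => /=.
  rewrite opprD addNKr normrN -scalerA normrZ ger0_norm//.
  by rewrite (le_lt_trans _ hr)// ler_piMl.
near=> h.
have h0 : h != 0 by near: h; exact: nbhs_dnbhs_neq.
have hr : `|h *: v| < r.
  rewrite normrZ.
  have : `|h| < r / (`|v| + 1).
    by near: h; apply: dnbhs0_lt; rewrite divr_gt0// ltr_wpDl.
  rewrite ltr_pdivlMr ?ltr_wpDl//; apply: le_lt_trans.
  by rewrite ler_wpM2l// lerDl.
have Bh : B (h *: v + x).
  by have [] := Bxh h hr 1; rewrite ?lexx ?ler01// mul1r addrC.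
rewrite /= -int01B; [|exact: G_continuous..].
pose D0 t := G j f t (h *: v + x) - G j f t x.
have cD0 t : 0 <= t <= 1 -> {for t, continuous D0}.
  move=> t01; apply: (@continuousB _ _ _ (G j f ^~ (h *: v + x)) (G j f ^~ x));
  exact: G_continuous.
rewrite -/D0 -[_ *: _]int01Z//; pose D t := h^-1 * D0 t.
have cD t : 0 <= t <= 1 -> {for t, continuous D}.
  move=> t01; apply: (@continuousM _ _ (cst h^-1) D0); last exact: cD0.
  exact: cst_continuous.
rewrite -/D -int01B//; last exact: G_continuous.
apply: int01_norm_le => [t t01|t t01].
  apply: (@continuousB _ _ _ (fun t => G j.+1 ('D_v f) t x) D); last exact: cD.
  exact: G_continuous.
have [|y [By Gy] E] := @line_MVT _ _ (G j f t) x v h _ (Bxh h hr).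
  by move=> y [By _]; have [] := G_derive j df By t01.
have [_ Dy] := G_derive j df By t01.
by rewrite /D /D0 [h *: v + x]addrC E mulKf// Dy distrC Gy.
Unshelve. all: end_near. Qed.

(** Each derivation raises the weight [j], so the induction on [k] is for all [j]. *)
Lemma Ck_radial_mean j k f : Ck k B f -> Ck k B (radial_mean j f).
Proof.
elim: k j f => [|k IH] j f Cf.
  by split=> //; apply: radial_mean_continuous; exact: Ck_continuous Cf.
split; first by apply: radial_mean_continuous; exact: Ck_continuous Cf.
move=> i; have [_ /(_ i)[df Cdf]] := Cf.
have cf := Ck_continuous Cf; have cdf := Ck_continuous Cdf.
have dr x : B x -> is_derive x (delta_mx 0 i) (radial_mean j f)
    (radial_mean j.+1 ('D_(delta_mx 0 i) f) x).
  exact: radial_mean_derive.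
split=> [x Bx|]; first by have [] := dr x Bx.
apply: (@eq_Ck _ _ _ _ (radial_mean j.+1 ('D_(delta_mx 0 i) f))) => //.
  by move=> x Bx; have [_ ->] := dr x Bx.
exact: IH.
Qed.

Lemma radial_mean_center f : radial_mean 0 f q = f q.
Proof.
rewrite -[RHS]int01_cst; congr int01; apply/funext => t.
by rewrite /G expr0 mul1r subrr scaler0 addr0.
Qed.

(** This is the fundamental theorem of calculus on the segment from [q] to [x]. *)
Lemma hadamard f x : Ck 1 B f -> B x ->
  f x = f q + \sum_i (x 0 i - q 0 i) * radial_mean 0 ('D_(delta_mx 0 i) f) x.
Proof.
move=> Cf Bx.
pose g i t := G 0 ('D_(delta_mx 0 i) f) t x.
have cdf i : contB ('D_(delta_mx 0 i) f) by have [_ /(_ i)[_ []]] := Cf.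
have cg i t : 0 <= t <= 1 -> {for t, continuous (g i)} by exact: G_continuous.
have B0 t : 0 <= t <= 1 -> B (q + t *: (x - q)) by exact: starB.
have dF t : 0 <= t <= 1 -> is_derive t 1 (fun t => f (q + t *: (x - q)))
    (\sum_i (x 0 i - q 0 i) * g i t).
  move=> t01; have dft := Ck1_differentiable oB Cf (B0 t t01).
  have := is_derive_line (@diff_derivable _ _ _ f _ (x - q) dft).
  rewrite differentiable_deriveE//; congr is_derive; apply: eq_bigr => i _.
  by rewrite !mxE /g /G expr0 mul1r.
have cg' i t : 0 <= t <= 1 -> {for t, continuous (fun t => (x 0 i - q 0 i) * g i t)}.
  move=> t01; apply: (@continuousM _ _ (cst (x 0 i - q 0 i)) (g i)); last exact: cg.
  exact: cst_continuous.
have [cs sE] := int01_sum (index_enum 'I_m) cg'.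
have := int01_FTC cs dF; rewrite sE scale1r scale0r addr0 [q + (x - q)]addrC subrK.
move=> FTC; rewrite -[LHS](subrK (f q)) -FTC addrC; congr (_ + _).
by apply: eq_bigr => i _; rewrite int01Z//; exact: cg.
Qed.

End Hadamard.

Lemma open_preimage_on (T S : topologicalType) (f : T -> S) (U : set T) (W : set S) :
  open U -> (forall x, U x -> {for x, continuous f}) -> open W ->
  open (U `&` f @^-1` W).
Proof.
move=> oU cf oW; rewrite openE => x [Ux Wfx]; apply: filterI.
  exact: (open_nbhs_nbhs (conj oU Ux)).
by apply: cf => //; exact: (open_nbhs_nbhs (conj oW Wfx)).
Qed.

(** * Coordinate vector fields on a manifold *)

Section CkLocal.
Variables (R : realType) (m : nat).
Implicit Types (U W : set 'rV[R]_m).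

Lemma CkS k U W f : W `<=` U -> Ck k U f -> Ck k W f.
Proof.
move=> WU; elim: k f => [|k IH] f [cf df].
  by split=> // x /WU; exact: cf.
split=> [x /WU|i]; first exact: cf.
by have [df1 df2] := df i; split=> [x /WU|]; [exact: df1|exact: IH].
Qed.

(** Regularity is local; this glues a cut-off function to zero. *)
Lemma CkU k U W f : Ck k U f -> Ck k W f -> Ck k (U `|` W) f.
Proof.
elim: k f => [|k IH] f [cU dU] [cW dW].
  by split=> // x [/cU|/cW].
split=> [x [/cU|/cW]|i] //.
have [dU1 dU2] := dU i; have [dW1 dW2] := dW i.
by split=> [x [/dU1|/dW1]|] //; exact: IH.
Qed.

End CkLocal.

(** * Cut-off extension of functions and coordinate fields from a chart *)

Section ChartExtension.
Variables (R : realType) (m : nat) (M : manifold R m) (c : chart R m M).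
Hypothesis Ac : atlas c.
Variables (x0 : 'rV[R]_m) (rho : R) (chi : 'rV[R]_m -> R).
Local Notation img := (fwd c @` dom c).
Hypothesis rho0 : 0 < rho.
Let B := [set x : 'rV[R]_m | `|x - x0| < rho].
Hypothesis Bimg : B `<=` img.
Hypothesis chi_smooth : forall k, Ck k setT chi.
Hypothesis chi_supp : forall x, chi x != 0 -> `|x - x0| < rho / 2.

Let oB : open B.
Proof.
rewrite (_ : B = ball x0 rho); first exact: ball_open.
by rewrite -ball_normE; apply/seteqP; split=> x /=; rewrite distrC.
Qed.

Let O := dom c `&` fwd c @^-1` B.

Let oO : open O.
Proof. by apply: open_preimage_on => //; [exact: dom_open|exact: fwd_continuous]. Qed.

Let K := bwd c @` [set x | `|x - x0| <= rho / 2].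

(** Here the Hausdorff property enters: [K], which contains the support of every extension by zero,
    is compact and hence closed. *)
Let closed_K : closed K.
Proof.
apply: compact_closed; first exact: manifold_hausdorff.
apply: continuous_compact.
  apply: continuous_in_subspaceT => x /[!inE] /= xK; apply: bwd_continuous.
  by apply: Bimg; rewrite /B /= (le_lt_trans xK)// ltr_pdivrMr// ltr_pMr// ltr1n.
apply: bounded_closed_compact.
  exists (`|x0| + rho / 2); split; first exact: num_real.
  move=> y ylt x /= xK; rewrite (le_trans _ (ltW ylt))//.
  by rewrite -[x](subrK x0) addrC (le_trans (ler_normD _ _))// lerD2l.
rewrite (_ : mkset _ = closed_ball x0 (rho / 2)); first exact: closed_ball_closed.
rewrite closed_ballE ?divr_gt0//.
by apply/seteqP; split=> x /=; rewrite /closed_ball_ /= distrC.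
Qed.

Definition extend (u : 'rV[R]_m -> R) (q : M) : R :=
  if `[< dom c q /\ `|fwd c q - x0| < rho >] then chi (fwd c q) * u (fwd c q) else 0.

Lemma extend_in u q : dom c q -> `|fwd c q - x0| < rho ->
  extend u q = chi (fwd c q) * u (fwd c q).
Proof. by move=> cq Bq; rewrite /extend asboolT. Qed.

Lemma extend_out u q : ~ (dom c q /\ `|fwd c q - x0| < rho) -> extend u q = 0.
Proof. by move=> nO; rewrite /extend asboolF. Qed.

(** Any other chart is covered by two open sets: on the preimage of [O] the extension is [chi * u]
    after a transition map, and off [K] it is zero. *)
Lemma extend_smooth u : smooth_on B u -> extend u \in @smooth_pred R m M.
Proof.
move=> su; apply/asboolP => d Ad k.
set W := fwd d @` dom d.
have oW : open W := img_open (c := d).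
have cd x : W x -> {for x, continuous (bwd d)} by exact: bwd_continuous.
pose W1 := W `&` bwd d @^-1` O; pose W2 := W `&` bwd d @^-1` (~` K).
have oW1 : open W1 by exact: open_preimage_on.
have oW2 : open W2 by apply: open_preimage_on => //; exact: closed_openC.
have W12 : W `<=` W1 `|` W2.
  move=> y Wy; have [Ky|nKy] := pselect (K (bwd d y)); last by right.
  left; split=> //; move: Ky => [x /= xK <-].
  have Bx : B x by rewrite /B /= (le_lt_trans xK)// ltr_pdivrMr// ltr_pMr// ltr1n.
  by have [q cq qx] := Bimg Bx; rewrite /O /= -qx fwdK ?inE//= qx.
apply: CkS W12 _; apply: CkU.
  have Cu : Ck k B (chi * u).
    by apply: CkM => //; apply: CkS (chi_smooth k).
  apply: (@eq_Ck _ _ _ _ ((chi * u) \o (fwd c \o bwd d))) => //.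
    by move=> y [Wy [cy By]]; rewrite /= extend_in.
  apply: (@Ck_comp _ _ _ _ _ B) => //; first by move=> y [_ []].
  move=> j; apply: CkS (atlas_compatible Ad Ac j k).
  by move=> y [[q dq <-]] [cq _]; exists q => //; split=> //; move: cq; rewrite fwdK ?inE.
apply: (@eq_Ck _ _ _ _ (cst 0)) => //; last exact: Ck_cst.
move=> y [Wy nKy] /=; apply/esym.
have [[cy By]|nO] := pselect (dom c (bwd d y) /\ `|fwd c (bwd d y) - x0| < rho).
  rewrite extend_in//; have [->|/chi_supp chiy] := eqVneq (chi (fwd c (bwd d y))) 0.
    by rewrite mul0r.
  exfalso; apply: nKy; exists (fwd c (bwd d y)); first exact: ltW.
  by rewrite fwdK ?inE.
by rewrite extend_out.
Qed.

Local Notation C := (cinfty M).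
Local Notation V := (vfield M).

Definition cextend u (su : smooth_on B u) : C := CInfty (extend_smooth su).

Let local_smooth (h : C) : smooth_on img (h \o bwd c).
Proof. by have /asboolP := valP h; exact. Qed.

Lemma partial_smooth (h : C) i :
  smooth_on B ('D_(delta_mx 0 i) (h \o bwd c)).
Proof.
move=> k; apply: CkS Bimg _.
by have [_ /(_ i)[_ Ck_h]] := local_smooth h k.+1; exact: Ck_h.
Qed.

(** This is [chi] times the [i]-th partial derivative, extended by zero. *)
Definition coord_fun i (h : C) : C := cextend (partial_smooth h i).

Lemma coord_fun_derivation i : coord_fun i \in @derivation_pred R m M.
Proof.
have dl (h : C) x : B x -> derivable (h \o bwd c) x (delta_mx 0 i).
  by move=> /Bimg Bx; have [_ /(_ i)[dh _]] := local_smooth h 1; exact: dh.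
apply/asboolP; split=> [a f h|f h]; apply: cinftyP => q; rewrite !cinftyE/=;
  have [[cq Bq]|nO] := pselect (dom c q /\ `|fwd c q - x0| < rho).
- have -> : (a *: f + h : C) \o bwd c = a *: (f \o bwd c) + (h \o bwd c) by [].
  rewrite !extend_in// deriveD; [|by apply: derivableZ; exact: dl|exact: dl].
  by rewrite deriveZ; [rewrite mulrDr mulrCA|exact: dl].
- by rewrite !extend_out// mulr0 addr0.
- have -> : (f * h : C) \o bwd c = (f \o bwd c) * (h \o bwd c) by [].
  rewrite !extend_in// deriveM; [|exact: dl|exact: dl].
  have fE (k : C) : (k \o bwd c) (fwd c q) = k q by rewrite /= fwdK ?inE.
  by rewrite !fE /GRing.scale/=; ring.
- by rewrite !extend_out// mulr0 mul0r addr0.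
Qed.

Definition coord_field i : V := VField (coord_fun_derivation i).

(** Global substitutes for the constant [1] and the coordinates, as a derivation acts only on
    functions defined on all of [M]. *)
Let chi1 : C := cextend (fun k => Ck_cst k B 1).
Let coord i : C := cextend (fun k => Ck_coord k B i).

(* The three factors [chi1] cut off the test function, the coordinate functions
   and the coordinate fields. *)
Lemma vfield_chart_expansion (Z : V) :
  (chi1 ^+ 3) *: Z =
  \sum_i (chi1 * Z (coord i) - coord i * Z chi1) *: coord_field i.
Proof.
apply: vfP => h; apply: cinftyP => q.
rewrite vfield_sumE cinfty_sumE vfieldZE.
have [[cq Bq]|nO] := pselect (dom c q /\ `|fwd c q - x0| < rho); last first.
  rewrite cinftyE exprS cinftyE [chi1 q]extend_out// !mul0r big1// => i _.
  by rewrite cinftyE [coord_field i h q]extend_out// mulr0.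
set a := fwd c q.
(* A ball is convex, hence star-shaped about any of its points [a], not only about its centre. *)
have starB x (t : R) : B x -> 0 <= t <= 1 -> B (a + t *: (x - a)).
  move=> Bx /andP[t0 t1]; rewrite /B /=.
  have -> : a + t *: (x - a) - x0 = t *: (x - x0) + (1 - t) *: (a - x0).
    by apply/rowP => i; rewrite !mxE; ring.
  rewrite (le_lt_trans (ler_normD _ _))// !normrZ ger0_norm// ger0_norm ?subr_ge0//.
  have [->|t_neq0] := eqVneq t 0; first by rewrite mul0r add0r subr0 mul1r.
  have t_gt0 : 0 < t by rewrite lt0r t_neq0.
  rewrite [ltRHS](_ : _ = t * rho + (1 - t) * rho); last by ring.
  by rewrite ltr_leD// ?ltr_pM2l// ler_wpM2l ?subr_ge0// ltW.
pose u i := radial_mean a 0 ('D_(delta_mx 0 i) (h \o bwd c)).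
have su i : smooth_on B (u i).
  by move=> k; apply: Ck_radial_mean => //; exact: partial_smooth.
pose U i : C := cextend (su i).
(* Hadamard's lemma for [h] about [a], multiplied by the square of the cut-off so that it becomes an
   identity in [C] to which [Z] applies. *)
have hE : h * chi1 ^+ 2 = h q *: chi1 ^+ 2 + \sum_i (coord i - a 0 i *: chi1) * U i.
  apply: cinftyP => q'; rewrite !cinftyE cinfty_sumE.
  have [[cq' Bq']|nO'] := pselect (dom c q' /\ `|fwd c q' - x0| < rho); last first.
    rewrite [chi1 q']extend_out// !(mul0r, mulr0) big1 ?addr0// => i _.
    by rewrite cinftyE [U i q']extend_out// mulr0.
  have C1 : Ck 1 B (h \o bwd c) by apply: CkS Bimg _; exact: local_smooth.
  have -> : h q' = h q + \sum_i (fwd c q' 0 i - a 0 i) * u i (fwd c q').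
    by have := hadamard oB starB C1 Bq'; rewrite /= !fwdK ?inE.
  rewrite [chi1 q']extend_in// mulr1 mulrDl; congr (_ + _).
  rewrite mulr_suml; apply: eq_bigr => i _.
  rewrite !cinftyE [coord i q']extend_in// [U i q']extend_in// [chi1 q']extend_in//.
  by rewrite /= /u; ring.
have Uq i : coord_field i h q = U i q.
  by rewrite [LHS]extend_in// [RHS]extend_in// /u radial_mean_center.
(* At [q] the derivatives of [chi1 ^+ 2] cancel, and since [coord i - a 0 i *: chi1] vanishes there,
   only its own derivative survives in the Leibniz rule. *)
have /(congr1 (fun f : C => f q)) := congr1 Z hE.
rewrite vfieldM vfieldD vfield_cst vfield_sum !cinftyE cinfty_sumE.
rewrite addrC => /addrI Zh.
have chiq : chi1 q = chi a by rewrite [LHS]extend_in// mulr1.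
have coordq i : coord i q = chi a * a 0 i by rewrite [LHS]extend_in.
rewrite -mulrA [X in _ * X]mulrC Zh mulr_sumr; apply: eq_bigr => i _.
rewrite vfieldM vfieldB vfield_cst !cinftyE Uq coordq chiq; ring.
Qed.

End ChartExtension.

(** In the chart expansion of [X], every coefficient is linear in values of [X] on functions and
    vanishes at [p], while the cut-off on the left does not. *)
Lemma metric_vanishes (R : realType) (m : nat) (M : manifold R m) (g : metric M)
    (X Y : vfield M) (p : M) : vanishes_at X p -> g X Y p = 0.
Proof.
move=> Xp; have [c Ac cp] := atlas_cover p.
have [rho /= rho0 rhoP] : nbhs_ball (fwd c p) (fwd c @` dom c).
  by apply/nbhs_ballP; apply: open_nbhs_nbhs; split; [exact: img_open|exists p].
have Bimg : [set x | `|x - fwd c p| < rho] `<=` fwd c @` dom c.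
  by move=> x /= xB; apply: rhoP; rewrite -ball_normE/= distrC.
have [chi [chi_smooth chi0 chi_supp]] : exists chi : 'rV[R]_m -> R,
    [/\ forall k, Ck k setT chi, 0 < chi (fwd c p) &
        forall x, chi x != 0 -> `|x - fwd c p| < rho / 2].
  by apply: bump_exists; rewrite divr_gt0.
have := vfield_chart_expansion Ac rho0 Bimg chi_smooth chi_supp X.
move=> /(congr1 (fun Z => g Z Y p)); rewrite metricZl metric_sumr cinftyE cinfty_sumE.
rewrite [RHS]big1 => [|i _]; last first.
  by rewrite metricZl !cinftyE !Xp !mulr0 subr0 mul0r.
rewrite 2!exprS expr1 !cinftyE /= extend_in ?subrr ?normr0// mulr1.
by move=> /eqP; rewrite !mulf_eq0 gt_eqF//= => /eqP.
Qed.

(** * The trace over the contact distribution *)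

Section Trace.
Variables (R : realType) (n : nat) (M : manifold R (2 * n).+1).
Local Notation C := (cinfty M).
Local Notation V := (vfield M).
Variables (eta : {linear V -> C | *%R}) (g : metric M) (p : M).

(** The expansion of [X] holds at [p] only: its difference with the constant-coefficient combination
    [W] vanishes there, and [metric_vanishes] applies. *)
Lemma orthonormal_expand e X : orthonormal_basis_D eta g p e -> eta X p = 0 ->
  exists c : 'I_(2 * n) -> R, forall Y, g X Y p = \sum_j c j * g (e j) Y p.
Proof.
move=> [_ _ gen] /gen[c cP]; exists c => Y.
pose W := \sum_j (c j *: (1 : C)) *: e j.
have : g (X - W) Y p = 0.
  apply: metric_vanishes => f; rewrite -[LHS]/(X f p - W f p) cP.
  rewrite /W vfield_sumE cinfty_sumE.
  apply/eqP; rewrite subr_eq0; apply/eqP/eq_bigr => j _.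
  by rewrite -[RHS]/(c j * 1 * e j f p) mulr1.
rewrite metricBl /W metric_sumr cinftyE cinftyNE cinfty_sumE => /eqP.
rewrite subr_eq0 => /eqP ->; apply: eq_bigr => j _.
by rewrite metricZl -[LHS]/(c j * 1 * _) mulr1.
Qed.

(** Expansion at [p] is available for a bare argument of [g]; self-adjointness moves [A] away from
    each slot in turn. *)
Lemma trace_D_basis e e' (A : V -> V) :
  (forall X Y, g (A X) Y = g X (A Y)) ->
  orthonormal_basis_D eta g p e -> orthonormal_basis_D eta g p e' ->
  trace_D g p e A = trace_D g p e' A.
Proof.
move=> sA oe oe'; have [_ ee _] := oe; have [e'0 e'e' _] := oe'.
have /choice[c cP] i := orthonormal_expand oe (e'0 i).
pose K := \matrix_(i, j) c i j.
have cE i j : g (e' i) (e j) p = c i j.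
  rewrite cP (bigD1 j)//= ee eqxx mulr1 big1 ?addr0// => k kj.
  by rewrite ee (negbTE kj) mulr0.
have K1 : K *m K^T = 1%:M.
  apply/matrixP => i l; rewrite !mxE -e'e' cP; apply: eq_bigr => j _.
  by rewrite !mxE Defs.metric_sym cE.
(* The rows of the transition matrix are orthonormal; as it is square, so are its columns, which is
   what the sum over [i] uses. *)
have /matrixP K2 := mulmx1C K1.
have dot j k : \sum_i c i j * c i k = (j == k)%:R.
  by have := K2 j k; rewrite !mxE => <-; apply: eq_bigr => i _; rewrite !mxE.
rewrite /trace_D; symmetry.
transitivity (\sum_i \sum_j \sum_k c i j * c i k * g (A (e j)) (e k) p).
  apply: eq_bigr => i _; rewrite sA cP; apply: eq_bigr => j _.
  rewrite -sA Defs.metric_sym cP mulr_sumr; apply: eq_bigr => k _.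
  by rewrite mulrA (Defs.metric_sym g (e k)).
rewrite exchange_big; apply: eq_bigr => j _ /=.
rewrite exchange_big (bigD1 j)//= [X in _ + X]big1 ?addr0 => [|k kj].
  by rewrite -mulr_suml dot eqxx mul1r.
by rewrite -mulr_suml dot eq_sym (negbTE kj) mul0r.
Qed.

End Trace.

Theorem proposition4p1 (R : realType) (n : nat) (M : manifold R (2 * n).+1)
    (phi Q : {linear vfield M -> vfield M}) (xi : vfield M)
    (eta : {linear vfield M -> cinfty M | *%R}) (g : metric M)
    (nabla : vfield M -> vfield M -> vfield M) :
  weak_K_contact phi Q xi eta g ->
  levi_civita g nabla ->
  (forall X Y : vfield M, curvature nabla xi X Y = nabla_endo nabla phi X Y) /\
  (forall X : vfield M, curvature nabla X xi xi = - phi (phi X)) /\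
  (forall (p : M) (e e' e'' : 'I_(2 * n) -> vfield M),
     orthonormal_basis_D eta g p e ->
     orthonormal_basis_D eta g p e' ->
     orthonormal_basis_D eta g p e'' ->
     Ric_xi nabla g xi p e = trace_D g p e' Q /\
     trace_D g p e' Q = (2 * n)%:R + trace_D g p e'' (fun X => Q X - X)).
Proof.
move=> wK lc; split; first exact: curvature_reeb_nabla_phi wK lc.
split=> [|p e e' e'' oe oe' oe'']; first exact: curvature_reeb_reeb wK lc.
have wacm := wcm_wacm (wK_wcm wK); have wac := wacm_wac wacm.
have sQ := Q_selfadjoint (wacm_metric wacm).
(* The three bases are unrelated, so traces of [Q] are first moved to a common basis. *)
have tr := @trace_D_basis _ _ _ eta g p _ _ Q sQ; split.
  rewrite -(tr _ _ oe oe'); apply: eq_bigr => i _.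
  (* Termwise, [- phi (phi X) = Q X - eta X *: xi], and [eta (e i)] vanishes at [p]. *)
  rewrite (curvature_reeb_reeb wK lc) (wac_phi2 wac) opprD opprK metricBl metricZl.
  by have [e0 _ _] := oe; rewrite !cinftyE e0 mul0r oppr0 addr0.
rewrite (tr _ _ oe' oe'') /trace_D.
under [in RHS]eq_bigr do rewrite metricBl cinftyE cinftyNE.
rewrite sumrB; have [_ ee _] := oe''.
under [X in _ - X]eq_bigr do rewrite ee eqxx.
by rewrite sumr_const card_ord addrC subrK.
Qed.
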